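(* Let $\mathbb{F}$ be a field, let $\mathcal{V}$ be an $\mathbb{F}$-vector space with a well-ordered basis $(\beta,\leq)$, and let $G$ be an arbitrary group. Then any $G$-grading on $\mathrm{UT}_\beta\mathcal{V}$ and any $G$-grading on $\mathrm{UT}^{\mathrm{fin}}_\beta\mathcal{V}$ has finite support and is isomorphic to an elementary grading, which is induced from a finite elementary $G$-grading on $\mathrm{UT}_{\to\beta}\mathcal{V}$. Furthermore, let $\eta,\eta'\colon\beta\to G$ be maps such that the elementary $G$-gradings $\Gamma(\eta)$ and $\Gamma(\eta')$ on $\mathrm{UT}_{\to\beta}\mathcal{V}$ are finite. Denote by $\overline{\Gamma(\eta)}$ and $\overline{\Gamma(\eta')}$ the respective induced gradings on $\mathrm{UT}_\beta\mathcal{V}$, and by $\widetilde{\Gamma(\eta)}$ and $\widetilde{\Gamma(\eta')}$ the respective induced gradings on $\mathrm{UT}^{\mathrm{fin}}_\beta\mathcal{V}$. Then the following statements are equivalent: (i) $\overline{\Gamma(\eta)}\cong\overline{\Gamma(\eta')}$; (ii) $\widetilde{\Gamma(\eta)}\cong\widetilde{\Gamma(\eta')}$; (iii) $\Gamma(\eta)=\Gamma(\eta')$; (iv) $\eta=g\eta'$ for some $g\in G$, where $(g\eta')(u)=g\,\eta'(u)$ for all $u\in\beta$.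
   Context: For $v\in\beta$ let $\mathcal{V}(v)=\mathrm{Span}\{w\in\beta\mid w\le v\}$. $\mathrm{UT}_\beta\mathcal{V}$ is the algebra of all $t\in\mathrm{End}_{\mathbb{F}}\mathcal{V}$ with $t(v)\in\mathcal{V}(v)$ for all $v\in\beta$. For $u,v\in\beta$, the matrix unit $e_{uv}\in\mathrm{End}_{\mathbb{F}}\mathcal{V}$ is defined by $e_{uv}(v)=u$ and $e_{uv}(w)=0$ for $w\in\beta\setminus\{v\}$. $\mathrm{UT}^{\mathrm{fin}}_\beta\mathcal{V}=\{t\in\mathrm{UT}_\beta\mathcal{V}\mid\dim t(\mathcal{V})<\infty\}$ and $\mathrm{UT}_{\to\beta}\mathcal{V}=\mathrm{Span}\{e_{uv}\mid u\le v\in\beta\}$. $\mathrm{End}_{\mathbb{F}}\mathcal{V}$ carries the finite topology (pointwise convergence, $\mathcal{V}$ discrete): a base of neighborhoods of $0$ is given by the sets $\{T\mid T|_{\mathcal{W}}=0\}$, $\mathcal{W}\subseteq\mathcal{V}$ finite-dimensional. Subalgebras have the subspace topology. A $G$-grading $\Gamma$ on an algebra $\mathcal{A}$ is a vector space decomposition $\mathcal{A}=\bigoplus_{g\in G}\mathcal{A}_g$ with $\mathcal{A}_g\mathcal{A}_h\subseteq\mathcal{A}_{gh}$ (components may be $0$). Its support is $\{g\mid\mathcal{A}_g\ne0\}$; it is finite if its support is finite. Two $G$-gradings $\mathcal{A}=\bigoplus_g\mathcal{A}_g=\bigoplus_g\mathcal{A}'_g$ are isomorphic ($\cong$) if there is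 an algebra automorphism $f$ of $\mathcal{A}$ with $f(\mathcal{A}_g)=\mathcal{A}'_g$ for all $g$; equality means $\mathcal{A}_g=\mathcal{A}'_g$ for all $g$. For $\mathrm{UT}_{\to\beta}\mathcal{V}\subseteq\mathcal{A}\subseteq\mathrm{UT}_\beta\mathcal{V}$, a $G$-grading on $\mathcal{A}$ is elementary if there is a map $\gamma\colon\beta\to G$ such that, for all $u\le v$ in $\beta$, $e_{uv}$ is homogeneous of degree $\gamma(u)^{-1}\gamma(v)$. For a map $\eta\colon\beta\to G$, $\Gamma(\eta)$ is the elementary grading on $\mathrm{UT}_{\to\beta}\mathcal{V}$ with $\deg e_{uv}=\eta(u)^{-1}\eta(v)$. If $\Gamma_0$ is a finite elementary grading on $\mathcal{A}_0=\mathrm{UT}_{\to\beta}\mathcal{V}$ with components $(\mathcal{A}_0)_g$, the grading it induces on $\mathcal{A}$ (for $\mathcal{A}=\mathrm{UT}_\beta\mathcal{V}$ or $\mathrm{UT}^{\mathrm{fin}}_\beta\mathcal{V}$) is the one whose component of degree $g$ is $\overline{(\mathcal{A}_0)_g}\cap\mathcal{A}$, with closure taken in $\mathrm{End}_{\mathbb{F}}\mathcal{V}$. *)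

(* Defs.v *)
From HB Require Import structures.
From mathcomp Require Import all_boot all_order all_algebra.
From mathcomp Require Import boolp classical_sets functions cardinality.
From mathcomp Require Import topology function_spaces.
From mathcomp Require wochoice.
Set Implicit Arguments.
Unset Strict Implicit.
Unset Printing Implicit Defensive.
Import Order.TTheory GRing.Theory.
Local Open Scope classical_set_scope.
Local Open Scope ring_scope.

Section Span.
Variables (F : fieldType) (U : lmodType F).

Definition lin_span (X : set U) : set U :=
  [set x | exists (n : nat) (c : 'I_n -> F) (y : 'I_n -> U),
     (forall i, X (y i)) /\ x = \sum_(i < n) c i *: y i].

Definition finite_dim (W : set U) := exists s : seq U, W = lin_span [set` s].

(* A basis is an indexed family; independence makes the family injective. *)
Definition is_basis (I : choiceType) (b : I -> U) :=
  (forall (s : seq I) (c : I -> F), uniq s ->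
     \sum_(i <- s) c i *: b i = 0 -> {in s, forall i, c i = 0}) /\
  lin_span (range b) = [set: U].

Lemma sub_lin_span (X : set U) : X `<=` lin_span X.
Proof.
move=> x Xx; exists 1%N, (fun=> 1), (fun=> x); split => //.
by rewrite big_ord1 scale1r.
Qed.

Lemma lin_span_linear (X : set U) (a : F) x y :
  lin_span X x -> lin_span X y -> lin_span X (a *: x + y).
Proof.
move=> [n [c [f [Xf ->]]]] [m [e [g [Xg ->]]]].
exists (n + m)%N, (fun i => match fintype.split i with inl j => a * c j | inr j => e j end),
  (fun i => match fintype.split i with inl j => f j | inr j => g j end); split.
  by move=> i; case: fintype.split.
rewrite big_split_ord /= scaler_sumr; congr (_ + _); apply: eq_bigr => i _.
  by rewrite (unsplitK (inl i)) scalerA.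
by rewrite (unsplitK (inr i)).
Qed.

Lemma lin_span0 (X : set U) : lin_span X 0.
Proof. by exists 0%N, (fun=> 0), (fun=> 0); split=> [[]//|]; rewrite big_ord0. Qed.

Lemma lin_span_submod (X : set U) : submod_closed [in lin_span X].
Proof.
split=> [|a x y]; rewrite !inE; first exact: lin_span0.
by move=> *; exact: lin_span_linear.
Qed.

Lemma lin_span_uniqE (I : choiceType) (b : I -> U) (X : set I) x :
  lin_span (b @` X) x -> exists (s : seq I) (c : I -> F),
  [/\ uniq s, {in s, forall i, X i} & x = \sum_(i <- s) c i *: b i].
Proof.
move=> [n [c [y [Xy ->]]]].
have /choice[j jP] : forall i, exists k, X k /\ b k = y i.
  by move=> i; have [k Xk bk] := Xy i; exists k.
pose s := undup [seq j i | i <- enum 'I_n].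
exists s, (fun k => \sum_(i | j i == k) c i); split.
- exact: undup_uniq.
- by move=> k; rewrite mem_undup => /mapP[i _ ->]; have [] := jP i.
under [RHS]eq_bigr do rewrite scaler_suml.
rewrite (exchange_big_dep predT) //=; apply: eq_bigr => i _.
under eq_bigl do rewrite eq_sym.
rewrite -big_filter filter_pred1_uniq ?undup_uniq //.
  by rewrite big_seq1; have [_ ->] := jP i.
by rewrite mem_undup map_f // mem_enum.
Qed.

End Span.

Definition well_ordered d (I : orderType d) :=
  wochoice.well_order (<=%O : rel I).

(* Endomorphisms of V are kept as plain functions V -> V, whose vector space
   structure is pointwise; the product of the algebra is composition (\o), not
   the pointwise product of functions. *)
Section UpperTriangular.
Variables (F : fieldType) (V : lmodType F) (d : Order.disp_t) (I : orderType d).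
Variable b : I -> V.

Definition initial_span (v : I) : set V := lin_span (b @` [set w | (w <= v)%O]).

Definition UT : set (V -> V) :=
  [set t | linear t /\ forall v, initial_span v (t (b v))].

Definition UTfin : set (V -> V) := [set t | UT t /\ finite_dim (range t)].

Definition is_matrix_unit (u v : I) (t : V -> V) :=
  [/\ linear t, t (b v) = b u & forall w, w != v -> t (b w) = 0].

(* Chosen by its defining property; matrix_unitP and matrix_unit_uniq show that
   this is the intended map as soon as b is a basis. *)
Definition matrix_unit (u v : I) : V -> V := xget 0 (is_matrix_unit u v).

Definition UTarrow : set (V -> V) :=
  lin_span [set t | exists u v, (u <= v)%O /\ t = matrix_unit u v].

End UpperTriangular.

Section MatrixUnits.
Variables (F : fieldType) (V : lmodType F) (d : Order.disp_t) (I : orderType d).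
Variables (b : I -> V) (bB : is_basis b).

Lemma basis_notin_span v : ~ lin_span (b @` [set w | w != v]) (b v).
Proof.
move=> /lin_span_uniqE[s [c [us sv bv]]].
have vs : v \notin s by apply/negP => /sv /=; rewrite eqxx.
have := bB.1 (v :: s) (fun k => if k == v then -1 else c k).
rewrite /= vs us => /(_ isT); rewrite big_cons eqxx scaleN1r {1}bv.
have -> : \sum_(j <- s) (if j == v then -1 else c j) *: b j = \sum_(j <- s) c j *: b j.
  by apply: eq_big_seq => k ks; case: eqP ks vs => // -> ->.
rewrite addNr => /(_ erefl v); rewrite inE eqxx => /(_ isT) /eqP.
by rewrite oppr_eq0 oner_eq0.
Qed.

Lemma matrix_unitP u v : is_matrix_unit b u v (matrix_unit b u v).
Proof.
apply: xgetPex; set H := lin_span (b @` [set w | w != v]).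
have ex x : exists a, H (x - a *: b v).
  have : lin_span (range b) x by rewrite bB.2.
  move=> [n [c [y [yP ->]]]].
  exists (\sum_(i | y i == b v) c i).
  rewrite (bigID (fun i => y i == b v)) /= scaler_suml.
  have -> : \sum_(i | y i == b v) c i *: y i = \sum_(i | y i == b v) c i *: b v.
    by apply: eq_bigr => i /eqP->.
  rewrite addrAC subrr add0r.
  elim/big_ind: _ => [|p q Hp Hq|i yi].
  - exact: lin_span0.
  - by rewrite -[p]scale1r; exact: lin_span_linear.
  rewrite -[_ *: _]addr0; apply: lin_span_linear; last first.
    exact: lin_span0.
  apply: sub_lin_span; have [w _ wE] := yP i; exists w => //=.
  by apply: contra_neq yi => wv; rewrite -wE wv.
have [a aP] := choice ex.
have H0 : H 0 by exact: lin_span0.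
have au x e : H (x - e *: b v) -> a x = e.
  move=> He; have [//|ne] := eqVneq (a x) e; exfalso.
  apply: (@basis_notin_span v).
  have := lin_span_linear (a x - e)^-1 (lin_span_linear (-1) (aP x) He) H0.
  by rewrite addr0 scaleN1r opprB addrA subrK -scalerBl scalerA mulVf ?subr_eq0 // scale1r.
exists (fun x => a x *: b u); split => [k x y|/=|w wv].
- rewrite scalerA -scalerDl; congr (_ *: _); apply: au.
  have := lin_span_linear k (aP x) (aP y).
  by rewrite scalerBr scalerA addrACA -opprD -scalerDl.
- by rewrite (au _ 1) ?scale1r // subrr.
- by rewrite (au _ 0) ?scale0r // subr0; apply: sub_lin_span; exists w.
Qed.

Lemma linear_basis_ext (f g : V -> V) :
  linear f -> linear g -> (forall i, f (b i) = g (b i)) -> f = g.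
Proof.
move=> lf lg fg; apply/funext => x.
have f0 : f 0 = 0 by have := lf (-1) 0 0; rewrite scaler0 addr0 scaleN1r addNr.
have g0 : g 0 = 0 by have := lg (-1) 0 0; rewrite scaler0 addr0 scaleN1r addNr.
have : lin_span (range b) x by rewrite bB.2.
move=> [n [c [y [yP ->]]]]; elim/big_ind: _ => [|p q fp fq|i _].
- by rewrite f0 g0.
- by rewrite -[p]scale1r lf lg fp fq.
- by have [w _ <-] := yP i; rewrite -[_ *: _]addr0 lf lg f0 g0 fg.
Qed.

Lemma matrix_unit_uniq u v t : is_matrix_unit b u v t -> t = matrix_unit b u v.
Proof.
move=> [lt tv tw]; have [lm mv mw] := matrix_unitP u v.
apply: linear_basis_ext => // w; have [->|wv] := eqVneq w v.
  by rewrite tv mv.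
by rewrite tw ?mw.
Qed.

End MatrixUnits.

(* The topology of pointwise convergence with V discrete: basic neighbourhoods
   of t are given by agreement with t on a finite set of vectors, that is, for
   linear maps, on a finite-dimensional subspace. *)
Lemma nbhs_ptwsP (V : choiceType) (t : {ptws V -> discrete_topology V}) (B : set (V -> V)) :
  nbhs t B <-> exists s : seq V, forall t', {in s, t' =1 t} -> B t'.
Proof.
pose FF : set_system (V -> V) := [set B | exists s : seq V, forall t', {in s, t' =1 t} -> B t'].
have fF : Filter FF.
  split; first by exists [::].
    move=> P Q [s sP] [r rQ]; exists (s ++ r) => t' h; split; [apply: sP|apply: rQ] => x xs;
    by apply: h; rewrite mem_cat xs ?orbT.
  by move=> P Q PQ [s sP]; exists s => t' /sP/PQ.
split.
  suff : FF --> t by exact.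
  apply/cvg_sup => x U [W [[O oO <-] /= Ox OU]].
  exists [:: x] => t' /(_ x (mem_head _ _)) E; apply: OU => /=.
  by rewrite E.
move=> [s sB].
suff : nbhs t [set t' : V -> V | {in s, t' =1 t}] by apply: (@filterS _ (nbhs t) (nbhs_filter t)).
elim: s {sB} => [|x s IH].
  by apply: (@filterS _ (nbhs t) (nbhs_filter t)) (@filterT _ (nbhs t) (nbhs_filter t)) => t' _ ?.
have hx : nbhs t [set t' : V -> V | t' x = t x].
  have := @proj_continuous V (fun=> discrete_topology V) x t [set t x].
  by apply; exact: discrete_set1.
apply: (@filterS2 _ (nbhs t) (nbhs_filter t)) hx IH => t' hx hs y.
by rewrite inE => /orP[/eqP->//|]; exact: hs.
Qed.

Lemma closure_ptwsP (V : choiceType) (S : set (V -> V)) (t : V -> V) :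
  closure (S : set {ptws V -> discrete_topology V}) t <->
  forall s : seq V, exists2 t', S t' & {in s, t' =1 t}.
Proof.
split=> [ct s|h B /nbhs_ptwsP[s sB]].
  have /ct[t' [St' tt']] : nbhs (t : {ptws V -> discrete_topology V})
      [set t' : V -> V | {in s, t' =1 t}] by apply/nbhs_ptwsP; exists s.
  by exists t'.
by have [t' St' /sB Bt'] := h s; exists t'.
Qed.

(* In all that follows A is a subalgebra of End V, and a grading of A is given
   by the family of its homogeneous components. *)
Section Gradings.
Variables (F : fieldType) (V : lmodType F) (G : groupType).
Implicit Types (A : set (V -> V)) (Gm : G -> set (V -> V)).

Record is_grading A Gm : Prop := IsGrading {
  grading_submod : forall g, submod_closed [in Gm g];
  grading_sub : forall g, Gm g `<=` A;
  grading_sum : forall a, A a -> exists (s : seq G) (x : G -> V -> V),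
    (forall g, Gm g (x g)) /\ a = \sum_(g <- s) x g;
  grading_direct : forall (s : seq G) (x : G -> V -> V), uniq s ->
    (forall g, Gm g (x g)) -> \sum_(g <- s) x g = 0 ->
    {in s, forall g, x g = 0};
  grading_mul : forall g h x y, Gm g x -> Gm h y -> Gm (g * h)%g (x \o y)
}.

Definition grading_support Gm : set G := [set g | exists2 x, Gm g x & x != 0].

Definition finite_support Gm := finite_set (grading_support Gm).

(* Only the values of f on A matter. *)
Definition is_automorphism A (f : (V -> V) -> (V -> V)) :=
  [/\ set_bij A A f,
      forall (c : F) x y, A x -> A y -> f (c *: x + y) = c *: f x + f y &
      forall x y, A x -> A y -> f (x \o y) = f x \o f y].

Definition grading_iso A Gm Gm' :=
  exists2 f, is_automorphism A f & forall g, f @` Gm g = Gm' g.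

(* End V has the subspace topology of {ptws V -> V} and A consists of linear
   maps, so intersecting with A the closure taken here or in End V gives the
   same set. *)
Definition induced_grading A Gm (g : G) : set (V -> V) :=
  closure (Gm g : set {ptws V -> discrete_topology V}) `&` A.

Section Elementary.
Variables (d : Order.disp_t) (I : orderType d) (b : I -> V).

Definition elementary Gm := exists gamma : I -> G, forall u v : I,
  (u <= v)%O -> Gm ((gamma u)^-1 * gamma v)%g (matrix_unit b u v).

Definition elementary_grading (eta : I -> G) (g : G) : set (V -> V) :=
  lin_span [set t | exists u v, [/\ (u <= v)%O, ((eta u)^-1 * eta v)%g = g &
                                t = matrix_unit b u v]].

End Elementary.
End Gradings.

(* Main.v *)
Require Import Defs.
From mathcomp Require Import all_boot all_order all_algebra.
From mathcomp Require Import boolp classical_sets functions cardinality.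
From mathcomp Require Import topology function_spaces.
Local Open Scope classical_set_scope.
Set Implicit Arguments.
Unset Strict Implicit.
Unset Printing Implicit Defensive.
Import Order.TTheory GRing.Theory.

(* Write V(u) and V(<u) for the spans of the basis vectors up to u, resp. before
   u, let A be the graded algebra and a_uu the diagonal entries of a.

   By well-founded induction on u, the ideal of the a in A with range in V(u) is
   graded and the character a |-> a_uu kills all homogeneous elements of degree
   other than 1. Annihilators of graded ideals are graded, so the ideal of range
   V(<u) is graded. Modulo it, A acts on the maps of range V(u) through the
   character, which forces the degree of any homogeneous a with a_uu <> 0 to have
   finite order; hence the map A -> F[G] sending a to the sum of (a_g)_uu g, a_g
   being the homogeneous components, has the trace property xy ~ yx in its
   coefficient of 1, and it kills the matrix units e_uj with j > u. Hence these
   kill the components of maps of range V(u).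

   The component a of degree 1 of e_uu then has range in V(u), kills V(<u) and
   has a_uu = 1, so a^2 is a homogeneous rank-one idempotent v_u (x) c_u of degree
   1. All v_u (x) c_w, u <= w, are homogeneous, of degree eta(u)^-1 eta(w), and the
   unitriangular change of basis b_u |-> v_u makes the grading elementary with
   degrees given by eta. The rank-one map v_0 (x) phi, with phi(v_u) = 1 for all
   u, is a finite sum of homogeneous elements, whence eta has finite range.

   Conversely, an automorphism sends the e_uu to primitive idempotents, each with
   a single nonzero diagonal entry; their positions define an order automorphism
   of the index set, hence the identity, and the degrees of the images of the
   matrix units are read off these entries. *)

(** * Coordinates with respect to the basis *)

Section Coordinates.
Local Open Scope ring_scope.
Variables (F : fieldType) (V : lmodType F) (I : choiceType) (b : I -> V).
Hypothesis bB : is_basis b.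

(** The coefficients are required to vanish off the list. This makes the coefficient function
    unique, although the list is not. *)
Definition expansion (x : V) (p : seq I * (I -> F)) : Prop :=
  [/\ uniq p.1, forall i, i \notin p.1 -> p.2 i = 0 &
      x = \sum_(i <- p.1) p.2 i *: b i].

Lemma expansion_exists x : exists p, expansion x p.
Proof.
have : lin_span (b @` setT) x by rewrite bB.2.
move=> /lin_span_uniqE[s [c [us _ ->]]].
exists (s, fun i => if i \in s then c i else 0); split => //= [i /negbTE->//|].
by apply: eq_big_seq => i ->.
Qed.

Definition supp (x : V) : seq I := (projT1 (cid (expansion_exists x))).1.
Definition bcoord (x : V) : I -> F := (projT1 (cid (expansion_exists x))).2.

Lemma expansion_supp x : expansion x (supp x, bcoord x).
Proof. exact: (projT2 (cid (expansion_exists x))). Qed.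

Lemma supp_uniq x : uniq (supp x).
Proof. by have [] := expansion_supp x. Qed.

Lemma bcoord_supp x i : i \notin supp x -> bcoord x i = 0.
Proof. by have [_ + _] := expansion_supp x; exact. Qed.

Lemma bcoord_sum x : x = \sum_(i <- supp x) bcoord x i *: b i.
Proof. by have [] := expansion_supp x. Qed.

Lemma big_supp (W : nmodType) (f : I -> W) (s r : seq I) :
  uniq s -> uniq r -> (forall i, i \notin s -> f i = 0) ->
  (forall i, i \notin r -> f i = 0) -> \sum_(i <- s) f i = \sum_(i <- r) f i.
Proof.
move=> us ur fs fr.
rewrite (bigID [in r]) /= [X in _ + X]big1 ?addr0; last by move=> i /fr.
rewrite [RHS](bigID [in s]) /= [X in _ = _ + X]big1 ?addr0; last by move=> i /fs.
rewrite -big_filter -[RHS]big_filter; apply: perm_big; apply: uniq_perm; rewrite ?filter_uniq //.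
by move=> i; rewrite !mem_filter andbC.
Qed.

Lemma expansion_bcoord x p : expansion x p -> bcoord x = p.2.
Proof.
case: p => s f [/= us fs xE]; apply/funext => i.
(* Both expansions are compared on one common list. The index [i] is added so that independence
   speaks about it even when it lies in neither support. *)
pose t := undup (i :: s ++ supp x).
have ut : uniq t by exact: undup_uniq.
have E (h : I -> F) r : uniq r -> {subset r <= t} -> (forall j, j \notin r -> h j = 0) ->
    \sum_(j <- r) h j *: b j = \sum_(j <- t) h j *: b j.
  move=> ur rt hr; apply: big_supp => // j; first by move/hr ->; rewrite scale0r.
  by move=> jt; rewrite hr ?scale0r //; apply: contra jt => /rt.
have := bcoord_sum x; rewrite {1}xE (E f) // ?(E (bcoord x)) //; first last.
- by move=> j js; rewrite mem_undup inE mem_cat js orbT.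
- exact: bcoord_supp.
- by move=> j js; rewrite mem_undup inE mem_cat js !orbT.
- exact: supp_uniq.
move=> /eqP; rewrite -subr_eq0 -sumrB.
under eq_bigr do rewrite -scalerBl.
move=> /eqP /(@bB.1 t (fun j => f j - bcoord x j) ut) /(_ i).
by rewrite mem_undup mem_head => /(_ isT) /eqP; rewrite subr_eq0 => /eqP.
Qed.

Lemma bcoordP a x y i : bcoord (a *: x + y) i = a * bcoord x i + bcoord y i.
Proof.
pose s := undup (supp x ++ supp y).
have us : uniq s by exact: undup_uniq.
have hx j : j \notin s -> bcoord x j = 0.
  by rewrite mem_undup mem_cat negb_or => /andP[/bcoord_supp].
have hy j : j \notin s -> bcoord y j = 0.
  by rewrite mem_undup mem_cat negb_or => /andP[_ /bcoord_supp].
have Es z : (forall j, j \notin s -> bcoord z j = 0) -> z = \sum_(i <- s) bcoord z i *: b i.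
  move=> hz; rewrite {1}[z]bcoord_sum; apply: big_supp => //; rewrite ?supp_uniq //.
    by move=> j /bcoord_supp ->; rewrite scale0r.
  by move=> j /hz ->; rewrite scale0r.
rewrite (@expansion_bcoord _ (s, fun j => a * bcoord x j + bcoord y j)) //; split => //=.
  by move=> j js; rewrite hx // hy // mulr0 addr0.
rewrite {1}(Es x hx) {1}(Es y hy) scaler_sumr -big_split; apply: eq_bigr => j _ /=.
by rewrite scalerA scalerDl.
Qed.

Lemma bcoord0 i : bcoord 0 i = 0.
Proof. by rewrite (@expansion_bcoord _ ([::], fun=> 0)) //; split => //; rewrite big_nil. Qed.

Lemma bcoordD x y i : bcoord (x + y) i = bcoord x i + bcoord y i.
Proof. by rewrite -[x in LHS]scale1r bcoordP mul1r. Qed.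

Lemma bcoordZ a x i : bcoord (a *: x) i = a * bcoord x i.
Proof. by rewrite -[_ *: _]addr0 bcoordP bcoord0 addr0. Qed.

Lemma bcoordB x y i : bcoord (x - y) i = bcoord x i - bcoord y i.
Proof. by rewrite addrC -scaleN1r bcoordP mulN1r addrC. Qed.

Lemma bcoord_bigsum (J : Type) (s : seq J) (P : pred J) (x : J -> V) i :
  bcoord (\sum_(j <- s | P j) x j) i = \sum_(j <- s | P j) bcoord (x j) i.
Proof.
elim/big_rec2: _ => [|j y z _ IH]; first exact: bcoord0.
by rewrite bcoordD IH.
Qed.

Lemma bcoord_basis i j : bcoord (b i) j = (j == i)%:R.
Proof.
rewrite (@expansion_bcoord _ ([:: i], fun j => (j == i)%:R)) //; split => //=.
  by move=> k; rewrite inE => /negbTE->.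
by rewrite big_seq1 eqxx scale1r.
Qed.

Lemma bcoord_inj x y : bcoord x =1 bcoord y -> x = y.
Proof.
move=> xy; apply/eqP; rewrite -subr_eq0 [x - y]bcoord_sum big1 // => i _.
by rewrite bcoordB xy subrr scale0r.
Qed.

Lemma bcoord_sum_on x s : uniq s -> (forall i, i \notin s -> bcoord x i = 0) ->
  forall (W : lmodType F) (h : I -> W),
  \sum_(i <- supp x) bcoord x i *: h i = \sum_(i <- s) bcoord x i *: h i.
Proof.
move=> us xs W h; apply: big_supp; rewrite ?supp_uniq // => i.
  by move/bcoord_supp ->; rewrite scale0r.
by move/xs ->; rewrite scale0r.
Qed.

Lemma basis_neq0 i : b i != 0.
Proof.
apply/eqP => /(congr1 (bcoord^~ i)); rewrite bcoord_basis bcoord0 eqxx => /eqP.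
by rewrite oner_eq0.
Qed.

(** The target is left arbitrary: [V] gives changes of basis, [F^o] gives linear functionals. *)
Definition lin_ext (W : lmodType F) (h : I -> W) (x : V) : W :=
  \sum_(i <- supp x) bcoord x i *: h i.

Lemma lin_ext_linear (W : lmodType F) (h : I -> W) : linear (lin_ext h).
Proof.
move=> a x y; rewrite /lin_ext.
pose s := undup (supp x ++ supp y).
have us : uniq s by exact: undup_uniq.
have hx j : j \notin s -> bcoord x j = 0.
  by rewrite mem_undup mem_cat negb_or => /andP[/bcoord_supp].
have hy j : j \notin s -> bcoord y j = 0.
  by rewrite mem_undup mem_cat negb_or => /andP[_ /bcoord_supp].
rewrite (bcoord_sum_on us hx) (bcoord_sum_on us hy) (bcoord_sum_on us); last first.
  by move=> i si; rewrite bcoordP hx ?hy // mulr0 addr0.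
rewrite scaler_sumr -big_split /=; apply: eq_bigr => i _.
by rewrite bcoordP scalerDl scalerA.
Qed.

Lemma lin_ext_basis (W : lmodType F) (h : I -> W) i : lin_ext h (b i) = h i.
Proof.
rewrite /lin_ext (@bcoord_sum_on _ [:: i]) // ?big_seq1 ?bcoord_basis ?eqxx ?scale1r //.
by move=> j; rewrite inE bcoord_basis => /negbTE ->.
Qed.

(** Through this criterion triangularity becomes the vanishing of all matrix entries below the
    diagonal. *)
Lemma lin_span_bcoord (X : set I) x :
  lin_span (b @` X) x <-> forall i, bcoord x i != 0 -> X i.
Proof.
split=> [/lin_span_uniqE[s [c [us sX ->]]] i|xX].
  rewrite bcoord_bigsum => /eqP h; apply: contrapT => Xi; apply: h.
  rewrite big_seq big1 // => j js; rewrite bcoordZ bcoord_basis.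
  by case: eqP => [ij|]; rewrite ?mulr0 //; case: Xi; rewrite ij; apply: sX.
rewrite [x]bcoord_sum; elim/big_ind: _ => [|y z yX zX|i _].
- exact: lin_span0.
- by rewrite -[y]scale1r; apply: lin_span_linear.
- have [->|/xX Xi] := eqVneq (bcoord x i) 0.
    by rewrite scale0r; apply: lin_span0.
  rewrite -[_ *: _]addr0; apply: lin_span_linear; last exact: lin_span0.
  by apply: sub_lin_span; exists i.
Qed.

End Coordinates.

(** * Linear maps as plain functions, their sums and compositions *)

Section LinearFunctions.
Local Open Scope ring_scope.
Variables (F : fieldType) (V W : lmodType F).

Lemma linear_fun0 (f : V -> W) : linear f -> f 0 = 0.
Proof. by move=> lf; have := lf (-1) 0 0; rewrite scaler0 addr0 scaleN1r addNr. Qed.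

Lemma linear_funD (f : V -> W) x y : linear f -> f (x + y) = f x + f y.
Proof. by move=> lf; rewrite -[x in LHS]scale1r lf scale1r. Qed.

Lemma linear_funZ (f : V -> W) a x : linear f -> f (a *: x) = a *: f x.
Proof. by move=> lf; rewrite -[a *: x]addr0 lf linear_fun0 // addr0. Qed.

Lemma linear_funB (f : V -> W) x y : linear f -> f (x - y) = f x - f y.
Proof. by move=> lf; rewrite addrC -scaleN1r lf scaleN1r addrC. Qed.

Lemma linear_fun_sum (J : Type) (s : seq J) (P : pred J) (x : J -> V) (f : V -> W) :
  linear f -> f (\sum_(j <- s | P j) x j) = \sum_(j <- s | P j) f (x j).
Proof.
move=> lf; elim/big_rec2: _ => [|j y z _ <-]; first exact: linear_fun0.
exact: linear_funD.
Qed.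

End LinearFunctions.

Section LinearFunctionSpace.
Local Open Scope ring_scope.
Variables (F : fieldType) (V : lmodType F).

Lemma linear_fct0 : linear (0 : V -> V).
Proof. by move=> a x y; rewrite /= scaler0 addr0. Qed.

Lemma linear_fct_comb a (f g : V -> V) : linear f -> linear g -> linear (a *: f + g).
Proof.
move=> lf lg c x y; rewrite !fctE lf lg.
by rewrite !scalerDr !scalerA mulrC addrACA.
Qed.

Lemma linear_comp (f g : V -> V) : linear f -> linear g -> linear (f \o g).
Proof. by move=> lf lg c x y /=; rewrite lg lf. Qed.

Lemma comp_sumr (J : Type) (s : seq J) (P : pred J) (f : V -> V) (x : J -> V -> V) :
  linear f -> f \o (\sum_(j <- s | P j) x j) = \sum_(j <- s | P j) (f \o x j).
Proof.
by move=> lf; apply/funext => v /=; rewrite !fct_sumE linear_fun_sum.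
Qed.

Lemma comp_suml (J : Type) (s : seq J) (P : pred J) (f : V -> V) (x : J -> V -> V) :
  (\sum_(j <- s | P j) x j) \o f = \sum_(j <- s | P j) (x j \o f).
Proof. by apply/funext => v /=; rewrite !fct_sumE. Qed.

End LinearFunctionSpace.

(** * Subspaces of finite-dimensional spaces *)

Section FiniteDimension.
Local Open Scope ring_scope.
Variables (F : fieldType) (V : lmodType F).

Lemma lin_span_min (X : set V) (W : set V) : W 0 ->
  (forall a x y, W x -> W y -> W (a *: x + y)) -> X `<=` W -> lin_span X `<=` W.
Proof.
move=> W0 Wl XW x [n [c [y [Xy ->]]]]; elim/big_ind: _ => [//|p q Wp Wq|i _].
  by rewrite -[p]scale1r; exact: Wl.
by rewrite -[_ *: _]addr0; apply: Wl => //; apply: XW.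
Qed.

Lemma lin_span_mono (X Y : set V) : X `<=` Y -> lin_span X `<=` lin_span Y.
Proof.
move=> XY; apply: lin_span_min; first exact: lin_span0.
  by move=> a x y; exact: lin_span_linear.
by apply: subset_trans XY _; exact: sub_lin_span.
Qed.

Lemma lin_span_cons (x : V) (s : seq V) y : lin_span [set` x :: s] y ->
  exists a, lin_span [set` s] (y - a *: x).
Proof.
move: y; apply: lin_span_min.
- by exists 0; rewrite scale0r subr0; exact: lin_span0.
- move=> c p q [a ha] [e he]; exists (c * a + e).
  have := lin_span_linear c ha he; rewrite scalerBr scalerA addrACA -opprD.
  by rewrite -scalerDl.
- move=> y /=; rewrite inE => /orP[/eqP->|ys].
    by exists 1; rewrite scale1r subrr; exact: lin_span0.
  by exists 0; rewrite scale0r subr0; apply: sub_lin_span.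
Qed.

(** Induction on the spanning list [x :: s]. The part of [W] inside the span of [s] is spanned by
    some [r]. If [W] is larger, one further vector [w], with nonzero coefficient at [x], clears the
    [x]-part of every element of [W], so [w :: r] spans. *)
Lemma finite_dim_sub (W : set V) (s : seq V) : W 0 ->
  (forall a x y, W x -> W y -> W (a *: x + y)) -> W `<=` lin_span [set` s] ->
  finite_dim W.
Proof.
elim: s W => [|x s IH] W W0 Wl Ws.
  exists [::]; apply/seteqP; split; first exact: Ws.
  by apply: lin_span_min.
pose U := W `&` lin_span [set` s].
have [|a p q [Wp sp] [Wq sq]||r Ur] := IH U.
- by split => //; exact: lin_span0.
- by split; [exact: Wl|exact: lin_span_linear].
- by move=> y [].
have UW : lin_span [set` r] `<=` W by rewrite -Ur => y [].
have [WU|] := pselect (W `<=` U).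
  by exists r; apply/seteqP; split => //; rewrite -Ur.
move=> /existsNP[w /not_implyP[Ww nUw]].
have [a wa] := lin_span_cons (Ws _ Ww).
have a0 : a != 0.
  apply: contra_notN nUw => /eqP a0; split => //.
  by move: wa; rewrite a0 scale0r subr0.
exists (w :: r); apply/seteqP; split; last first.
  apply: lin_span_min => // y /=; rewrite inE => /orP[/eqP->//|yr].
  by apply: UW; apply: sub_lin_span.
move=> y Wy; have [e ye] := lin_span_cons (Ws _ Wy).
have Uy : U (- (e / a) *: w + y).
  split; first exact: Wl.
  have := lin_span_linear (- (e / a)) wa ye.
  by rewrite scalerBr scalerA mulNr divfK // [- e *: x]scaleNr opprK addrACA subrr addr0.
have -> : y = (e / a) *: w + (- (e / a) *: w + y) by rewrite addrA -scalerDl subrr scale0r add0r.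
apply: lin_span_linear; first by apply: sub_lin_span; rewrite /= mem_head.
apply: (@lin_span_mono [set` r]); last by rewrite -Ur.
by move=> z /= zr; rewrite inE zr orbT.
Qed.

End FiniteDimension.

(** * Well-ordered index sets *)

Section WellOrder.
Variables (d : Order.disp_t) (I : orderType d).
Hypothesis I_wo : well_ordered I.

Lemma well_ordered_ind (P : I -> Prop) :
  (forall u, (forall w, (w < u)%O -> P w) -> P u) -> forall u, P u.
Proof.
move=> step u; apply: contrapT => nPu.
have [|z [[/asboolP nPz zmin] _]] := I_wo (A := [pred w | `[< ~ P w >]]).
  by exists u; apply/asboolP.
apply: nPz; apply: step => w wz; apply: contrapT => nPw.
have := zmin w; rewrite inE => /(_ nPw).
by rewrite leNgt wz.
Qed.

Lemma well_ordered_min (u : I) : exists o : I, forall v, (o <= v)%O.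
Proof.
have [|z [[_ zmin] _]] := I_wo (A := predT); first by exists u.
by exists z => v; apply: zmin.
Qed.

Lemma seq_max (s : seq I) : s != [::] ->
  exists2 i, i \in s & {in s, forall j, (j <= i)%O}.
Proof.
elim: s => // x s IH _; have [->|/IH[i si imax]] := eqVneq s [::].
  by exists x; rewrite ?mem_head // => j; rewrite inE => /eqP->.
have [xi|ix] := leP x i.
  exists i; first by rewrite inE si orbT.
  by move=> j; rewrite inE => /orP[/eqP->|/imax].
exists x; rewrite ?mem_head // => j; rewrite inE => /orP[/eqP->//|/imax ji].
exact: le_trans ji (ltW ix).
Qed.

(** If f(u) < u, monotonicity gives f(f(u)) < f(u), against the induction hypothesis at f(u). *)
Lemma strict_mono_ge (f : I -> I) :
  {homo f : u v / (u < v)%O} -> forall u, (u <= f u)%O.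
Proof.
move=> fm; elim/well_ordered_ind => u IH; rewrite leNgt; apply/negP => fu.
by have := IH _ fu; rewrite leNgt (fm _ _ fu).
Qed.

End WellOrder.

(** * Triangular maps, maps of rank one, and ideals of the triangular algebra *)

Section Triangular.
Local Open Scope ring_scope.
Variables (F : fieldType) (V : lmodType F) (d : Order.disp_t) (I : orderType d).
Variable b : I -> V.
Hypothesis bB : is_basis b.
Local Notation co := (bcoord bB).

Lemma leading_index x : x != 0 ->
  exists i, co x i != 0 /\ forall j, co x j != 0 -> (j <= i)%O.
Proof.
move=> x0; pose s := [seq i <- supp bB x | co x i != 0].
have ms j : co x j != 0 -> j \in s.
  move=> cj; rewrite mem_filter cj /=; apply: contra_neqT cj; exact: bcoord_supp.
have [|i] := @seq_max _ _ s.
  apply/eqP => s0; case/eqP: x0; apply: (bcoord_inj (bB := bB)) => j; rewrite bcoord0.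
  by apply: contra_eq s0 => /ms; case: (s).
rewrite mem_filter => /andP[ci _] imax; exists i; split => // j /ms; exact: imax.
Qed.

Lemma UT_bcoord t : UT b t <->
  linear t /\ forall i j, co (t (b j)) i != 0 -> (i <= j)%O.
Proof.
split=> -[lt h]; split => //.
  by move=> i j; have /(lin_span_bcoord bB) := h j; exact.
by move=> v; apply/(lin_span_bcoord bB) => i /h.
Qed.

Lemma UT_linear t : UT b t -> linear t. Proof. by case. Qed.

Lemma UT_le t x u : UT b t -> (forall i, co x i != 0 -> (i <= u)%O) ->
  forall i, co (t x) i != 0 -> (i <= u)%O.
Proof.
move=> /UT_bcoord[lt ht] hx i; apply: contraNT; rewrite -ltNge => ui.
rewrite {1}(bcoord_sum bB x) linear_fun_sum // bcoord_bigsum big1 // => j _.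
rewrite linear_funZ // bcoordZ; have [->|/hx ju] := eqVneq (co x j) 0; first by rewrite mul0r.
have [->|/ht ij] := eqVneq (co (t (b j)) i) 0; first by rewrite mulr0.
by have := lt_le_trans ui (le_trans ij ju); rewrite ltxx.
Qed.

(** As [u] may be a limit, V(<u) need not be some V(k). The bound goes through the leading index of
    the single vector [x]. *)
Lemma UT_lt t x u : UT b t -> (forall i, co x i != 0 -> (i < u)%O) ->
  forall i, co (t x) i != 0 -> (i < u)%O.
Proof.
move=> tU hx i ci.
have [x0|/leading_index[k [ck kmax]]] := eqVneq x 0.
  by move: ci; rewrite x0 linear_fun0 ?bcoord0 ?eqxx //; exact: UT_linear tU.
exact: le_lt_trans (UT_le tU kmax ci) (hx _ ck).
Qed.

(** Removing the [b u] term from [x] leaves a vector of V(<u), which [t] keeps in V(<u). *)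
Lemma UT_diag t x u : UT b t -> (forall i, co x i != 0 -> (i <= u)%O) ->
  co (t x) u = co (t (b u)) u * co x u.
Proof.
move=> tU hx; have lt := UT_linear tU.
have hr i : co (x - co x u *: b u) i != 0 -> (i < u)%O.
  rewrite bcoordB bcoordZ bcoord_basis; have [->|iu] := eqVneq i u.
    by rewrite mulr1 subrr eqxx.
  by rewrite mulr0 subr0 lt_neqAle iu => /hx.
have := UT_lt tU hr (i := u); rewrite ltxx linear_funB // linear_funZ // bcoordB bcoordZ.
move=> h; apply/eqP; rewrite -subr_eq0 mulrC.
by apply: contraT => /h.
Qed.

Lemma UT_comp s t : UT b s -> UT b t -> UT b (s \o t).
Proof.
move=> sU tU; apply/UT_bcoord; split.
  by apply: linear_comp; apply: UT_linear.
move=> i j; apply: (UT_le sU) => k; have /UT_bcoord[_] := tU; exact.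
Qed.

Lemma UT_comb c s t : UT b s -> UT b t -> UT b (c *: s + t).
Proof.
move=> /UT_bcoord[ls hs] /UT_bcoord[lt ht]; apply/UT_bcoord; split.
  exact: linear_fct_comb.
move=> i j; rewrite fctE /= bcoordP; apply: contraNT => ij.
rewrite (contraNeq (@hs i j)) // (contraNeq (@ht i j)) //.
by rewrite mulr0 addr0.
Qed.

(** The tensor w (x) phi. *)
Definition rank1 (w : V) (phi : V -> F) : V -> V := fun x => phi x *: w.

Lemma rank1_linear w phi : scalar phi -> linear (rank1 w phi).
Proof. by move=> lp c x y; rewrite /rank1 lp scalerDl scalerA. Qed.

Lemma scalar0 (phi : V -> F) : scalar phi -> phi 0 = 0.
Proof. by move=> /(_ (-1) 0 0); rewrite scaler0 addr0 mulN1r addNr. Qed.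

Definition rank1_triangular (w : V) (phi : V -> F) :=
  forall i j, co w i != 0 -> phi (b j) != 0 -> (i <= j)%O.

Lemma rank1_UT w phi : scalar phi -> rank1_triangular w phi -> UT b (rank1 w phi).
Proof.
move=> lp h; apply/UT_bcoord; split; first exact: rank1_linear.
by move=> i j; rewrite bcoordZ mulf_eq0 negb_or => /andP[pj /h]; exact.
Qed.

(* UT and UT^fin are both two-sided ideals of UT containing all triangular maps
   of rank one; nothing else about them is used. *)
Record UT_ideal (A : set (V -> V)) : Prop := UTIdeal {
  UT_ideal_sub : A `<=` UT b;
  UT_ideal_comb : forall c x y, A x -> A y -> A (c *: x + y);
  UT_ideal_mul : forall s a t, UT b s -> A a -> UT b t -> A (s \o a \o t);
  UT_ideal_rank1 : forall w phi, scalar phi -> rank1_triangular w phi -> A (rank1 w phi)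
}.

Lemma UT_UT_ideal : UT_ideal (UT b).
Proof.
split => //; first by move=> *; exact: UT_comb.
  by move=> s a t sU aU tU; apply: UT_comp => //; apply: UT_comp.
exact: rank1_UT.
Qed.

Lemma finite_dim_range (f : V -> V) : linear f ->
  finite_dim (range f) <-> exists s : seq V, range f `<=` lin_span [set` s].
Proof.
move=> lf; split => [[s fs]|[s fs]]; first by exists s; rewrite fs.
apply: finite_dim_sub fs; first by exists 0; rewrite ?linear_fun0.
by move=> a p q [x _ <-] [y _ <-]; exists (a *: x + y); rewrite ?lf.
Qed.

Lemma UTfin_UT_ideal : UT_ideal (UTfin b).
Proof.
split; [by move=> a []|move=> c x y [xU xf] [yU yf]|move=> s a t sU [aU af] tU|move=> w phi lp h].
- split; first exact: UT_comb.
  apply/(finite_dim_range (UT_linear (UT_comb c xU yU))).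
  have [s xs] := (finite_dim_range (UT_linear xU)).1 xf.
  have [r yr] := (finite_dim_range (UT_linear yU)).1 yf.
  exists (s ++ r) => _ [v _ <-]; rewrite fctE /=; apply: lin_span_linear.
    apply: (lin_span_mono (X := [set` s])); last by apply: xs; exists v.
    by move=> z /= zs; rewrite mem_cat zs.
  apply: (lin_span_mono (X := [set` r])); last by apply: yr; exists v.
  by move=> z /= zs; rewrite mem_cat zs orbT.
- have U : UT b (s \o a \o t) by apply: UT_comp => //; apply: UT_comp.
  split => //; apply/(finite_dim_range (UT_linear U)).
  have [r ar] := (finite_dim_range (UT_linear aU)).1 af.
  have ls := UT_linear sU.
  exists (map s r) => _ [v _ <-] /=.
  have := ar (a (t v)); have /[swap] /[apply] : range a (a (t v)) by exists (t v).
  move: (a (t v)); apply: lin_span_min.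
  + by rewrite /= linear_fun0 //; exact: lin_span0.
  + by move=> c x y /= hx hy; rewrite ls; apply: lin_span_linear.
  + by move=> z /= zr; apply: sub_lin_span; rewrite /= map_f.
- split; first exact: rank1_UT.
  apply/(finite_dim_range (rank1_linear w lp)).
  exists [:: w] => _ [v _ <-]; rewrite /rank1 -[_ *: _]addr0; apply: lin_span_linear.
    by apply: sub_lin_span; rewrite /= mem_head.
  exact: lin_span0.
Qed.

Lemma matrix_unitE u v : matrix_unit b u v = rank1 (b u) (co^~ v).
Proof.
apply/esym/(matrix_unit_uniq bB); split.
- by apply: rank1_linear => c x y; exact: bcoordP.
- by rewrite /rank1 bcoord_basis eqxx scale1r.
- by move=> w wv; rewrite /rank1 bcoord_basis eq_sym (negbTE wv) scale0r.
Qed.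

End Triangular.

(** * Homogeneous components and annihilators in a graded algebra *)

Section HomogeneousComponents.
Local Open Scope ring_scope.
Variables (F : fieldType) (V : lmodType F) (G : groupType).
Variables (A : set (V -> V)) (Gm : G -> set (V -> V)).
Hypothesis gr : is_grading A Gm.

Lemma grading0 g : Gm g 0.
Proof. by have [] := grading_submod gr g; rewrite inE. Qed.

Lemma grading_comb g c x y : Gm g x -> Gm g y -> Gm g (c *: x + y).
Proof.
by have [_ h] := grading_submod gr g; have := h c x y; rewrite !inE.
Qed.

Lemma gradingZ g c x : Gm g x -> Gm g (c *: x).
Proof. by move=> gx; rewrite -[_ *: _]addr0; apply: grading_comb => //; exact: grading0. Qed.

Definition decomposition (a : V -> V) (f : G -> V -> V) : Prop :=
  (forall g, Gm g (f g)) /\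
  exists s, [/\ uniq s, forall g, g \notin s -> f g = 0 & a = \sum_(g <- s) f g].

Lemma decomposition_unique a f f' :
  decomposition a f -> decomposition a f' -> f = f'.
Proof.
move=> [Gf [s [us fs aE]]] [Gf' [s' [us' fs' aE']]]; apply/funext => g.
pose t := undup (g :: s ++ s').
have ut : uniq t by exact: undup_uniq.
have E (h : G -> V -> V) r : uniq r -> {subset r <= t} -> (forall j, j \notin r -> h j = 0) ->
    \sum_(j <- r) h j = \sum_(j <- t) h j.
  move=> ur rt hr; apply: big_supp => // j jt.
  by rewrite hr //; apply: contra jt => /rt.
have D h : Gm h (f h - f' h) by rewrite addrC -scaleN1r; apply: grading_comb.
have := grading_direct gr ut D; rewrite sumrB -(E f s) // -?(E f' s') //; first last.
- by move=> j js; rewrite mem_undup inE mem_cat js orbT.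
- by move=> j js; rewrite mem_undup inE mem_cat js !orbT.
rewrite -aE -aE' subrr => /(_ erefl g); rewrite mem_undup mem_head => /(_ isT) /eqP.
by rewrite subr_eq0 => /eqP.
Qed.

Definition component (a : V -> V) : G -> V -> V := xget (fun=> 0) (decomposition a).

Lemma componentP a : A a -> decomposition a (component a).
Proof.
move=> /(grading_sum gr)[s [x [Gx ->]]]; apply: xgetPex.
(* The list [s] may repeat a degree, so [x g] enters with its multiplicity. *)
exists (fun g => x g *+ count_mem g s); split.
  by move=> g; rewrite -scaler_nat; apply: gradingZ.
exists (undup s); split; first exact: undup_uniq.
- by move=> g; rewrite mem_undup => /count_memPn ->.
- by rewrite -big_undup_iterop_count.
Qed.

Lemma componentE a f : decomposition a f -> component a = f.
Proof.
move=> D; apply: decomposition_unique (D).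
by apply: xgetPex; exists f.
Qed.

Lemma component_homogeneous a g : A a -> Gm g (component a g).
Proof. by move=> /componentP[]. Qed.

Lemma component_sub a g : A a -> A (component a g).
Proof. by move=> Aa; apply: (grading_sub gr (g := g)); exact: component_homogeneous. Qed.

Lemma component_sum a : A a -> exists s, [/\ uniq s,
  forall g, g \notin s -> component a g = 0 & a = \sum_(g <- s) component a g].
Proof. by move=> /componentP[]. Qed.

Lemma component_comb c x y g : A x -> A y ->
  component (c *: x + y) g = c *: component x g + component y g.
Proof.
move=> Ax Ay; have [Gx [s [us xs xE]]] := componentP Ax.
have [Gy [r [ur yr yE]]] := componentP Ay.
rewrite (@componentE _ (fun g => c *: component x g + component y g)) //; split.
  by move=> h; apply: grading_comb.
pose t := undup (s ++ r); exists t; split; first exact: undup_uniq.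
  move=> h; rewrite mem_undup mem_cat negb_or => /andP[/xs -> /yr ->].
  by rewrite scaler0 addr0.
rewrite big_split /= -scaler_sumr {1}xE {1}yE; congr (_ *: _ + _);
  apply: big_supp; rewrite ?undup_uniq // => h; rewrite mem_undup mem_cat negb_or.
  by case/andP => /xs.
by case/andP => _ /yr.
Qed.

Lemma component_homog g x h : Gm g x -> component x h = if h == g then x else 0.
Proof.
move=> Gx; rewrite (@componentE _ (fun h => if h == g then x else 0)) //; split.
  by move=> k; case: eqP => [->//|_]; exact: grading0.
exists [:: g]; split => //; last by rewrite big_seq1 eqxx.
by move=> k; rewrite inE => /negbTE ->.
Qed.

Lemma grading_degree_unique g h x : Gm g x -> Gm h x -> x != 0 -> g = h.
Proof.
move=> gx hx; apply: contra_neq_eq => gh.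
by have := component_homog g hx; rewrite (component_homog g gx) eqxx (negbTE gh).
Qed.

Hypothesis A_comb : forall c x y, A x -> A y -> A (c *: x + y).
Hypothesis A_linear : forall x, A x -> linear x.
Hypothesis A_comp : forall x y, A x -> A y -> A (x \o y).

Lemma grading_mem0 : A 0. Proof. exact: grading_sub gr (1%g) _ (grading0 _). Qed.

Lemma component_bigsum (J : Type) (s : seq J) (P : pred J) (y : J -> V -> V) h :
  (forall j, A (y j)) ->
  component (\sum_(j <- s | P j) y j) h = \sum_(j <- s | P j) component (y j) h.
Proof.
move=> Ay.
suff [//] : A (\sum_(j <- s | P j) y j) /\
  component (\sum_(j <- s | P j) y j) h = \sum_(j <- s | P j) component (y j) h.
elim/big_rec2: _ => [|j x z _ [Ax <-]].
  by split; [exact: grading_mem0|rewrite (component_homog _ (grading0 1%g)) if_same].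
rewrite -[y j]scale1r; split; first by apply: A_comb.
by rewrite component_comb // !scale1r.
Qed.

(** Multiplying the decomposition of [x] by [a] shifts all degrees by [g] and is again a
    decomposition; decompositions are unique. *)
Lemma component_mull g a x h : Gm g a -> A x ->
  component (a \o x) h = a \o component x (g^-1 * h)%g.
Proof.
move=> Ga Ax; have [Gx [s [us xs xE]]] := componentP Ax.
have la : linear a by apply: A_linear; exact: (grading_sub gr Ga).
have a0 : a \o (0 : V -> V) = 0 :> (V -> V) by apply/funext => v /=; rewrite linear_fun0.
rewrite (@componentE _ (fun h => a \o component x (g^-1 * h)%g)) //; split.
  by move=> k; rewrite -[k in Gm k](mulVKg g); apply: (grading_mul gr).
exists (map (fun k => g * k)%g s); split.
- by rewrite map_inj_uniq //; exact: mulgI.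
- move=> k ks; rewrite xs //; apply: contra ks => ks.
  by rewrite -[k](mulVKg g) map_f.
- rewrite big_map {1}xE comp_sumr //; apply: eq_bigr => k _.
  by rewrite mulKg.
Qed.

Lemma component_mulr g a x h : Gm g a -> A x ->
  component (x \o a) h = component x (h * g^-1)%g \o a.
Proof.
move=> Ga Ax; have [Gx [s [us xs xE]]] := componentP Ax.
rewrite (@componentE _ (fun h => component x (h * g^-1)%g \o a)) //; split.
  by move=> k; rewrite -[k in Gm k](mulgVK g); apply: (grading_mul gr).
exists (map (fun k => k * g)%g s); split.
- by rewrite map_inj_uniq //; exact: mulIg.
- move=> k ks; rewrite xs //; apply: contra ks => ks.
  by apply/mapP; exists (k * g^-1)%g; rewrite ?mulgVK.
- rewrite big_map {1}xE comp_suml //; apply: eq_bigr => k _.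
  by rewrite mulgK.
Qed.

(** With y split into its y_h, the product a_g y_h is the component of degree gh of a y_h, which is
    0. *)
Lemma left_annihilator a y : A a -> A y ->
  (forall h, a \o component y h = 0) -> forall g, component a g \o y = 0.
Proof.
move=> Aa Ay ay g; have [_ [s [us ys yE]]] := componentP Ay.
have la : linear (component a g) by apply: A_linear; apply: component_sub.
rewrite yE comp_sumr // big1 // => h _.
have := component_mulr (g * h)%g (component_homogeneous h Ay) Aa.
by rewrite mulgK ay (component_homog _ (grading0 1%g)) if_same.
Qed.

Lemma right_annihilator a y : A a -> A y ->
  (forall h, component a h \o y = 0) -> forall g, a \o component y g = 0.
Proof.
move=> Aa Ay ay g; have [_ [s [us as_ aE]]] := componentP Aa.
rewrite {1}aE comp_suml big1 // => h _.
have := component_mull (h * g)%g (component_homogeneous h Aa) Ay.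
by rewrite mulKg ay (component_homog _ (grading0 1%g)) if_same.
Qed.

End HomogeneousComponents.

(** * The flag of graded ideals and the diagonal characters *)

Section Characters.
Local Open Scope ring_scope.
Variables (F : fieldType) (V : lmodType F) (d : Order.disp_t) (I : orderType d).
Variables (b : I -> V) (G : groupType).
Hypotheses (I_wo : well_ordered I) (bB : is_basis b).
Variables (A : set (V -> V)) (Gm : G -> set (V -> V)).
Hypotheses (idA : UT_ideal bB A) (gr : is_grading A Gm).
Local Notation co := (bcoord bB).
Local Notation hc := (component Gm).

Lemma ideal_comb c x y : A x -> A y -> A (c *: x + y).
Proof. by move=> Ax Ay; exact: (UT_ideal_comb idA). Qed.

Lemma ideal_UT a : A a -> UT b a. Proof. exact: UT_ideal_sub idA a. Qed.

Lemma ideal_linear a : A a -> linear a.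
Proof. by move/ideal_UT/UT_linear. Qed.

Lemma UT_id : UT b id.
Proof.
apply/(UT_bcoord bB); split => // i j; rewrite bcoord_basis.
by case: (eqVneq i j) => [->|_] //; rewrite eqxx.
Qed.

Lemma ideal_comp x y : A x -> A y -> A (x \o y).
Proof. by move=> Ax Ay; have := UT_ideal_mul idA (ideal_UT Ax) Ay UT_id. Qed.

(** The explicit form of [matrix_unit], see [matrix_unitE]. *)
Definition munit u v : V -> V := rank1 (b u) (co^~ v).

Lemma munit_basis u v w : munit u v (b w) = (v == w)%:R *: b u.
Proof. by rewrite /munit /rank1 bcoord_basis. Qed.

Lemma ideal_munit u v : (u <= v)%O -> A (munit u v).
Proof.
move=> uv; apply: (UT_ideal_rank1 idA); first by move=> c x y; exact: bcoordP.
move=> i j; rewrite !bcoord_basis; case: (eqVneq i u) => [->|]; rewrite ?eqxx //.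
by case: (eqVneq v j) => [<-|]; rewrite ?eqxx.
Qed.

Definition range_in (P : pred I) (a : V -> V) := forall x i, co (a x) i != 0 -> P i.

Definition kills_lt u (a : V -> V) := forall w, (w < u)%O -> a (b w) = 0.

Definition diag u (a : V -> V) : F := co (a (b u)) u.

Definition graded (S : (V -> V) -> Prop) := forall a, A a -> S a -> forall g, S (hc a g).

Lemma range_in_comb P c x y : range_in P x -> range_in P y -> range_in P (c *: x + y).
Proof.
move=> hx hy v i; rewrite fctE /= bcoordP; apply: contraNT => Pi.
by rewrite (contraNeq (@hx v i)) // (contraNeq (@hy v i)) // mulr0 addr0.
Qed.

Lemma range_in0 P : range_in P 0.
Proof. by move=> v i; rewrite bcoord0 eqxx. Qed.

Lemma range_inZ P c x : range_in P x -> range_in P (c *: x).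
Proof. by move=> hx; rewrite -[_ *: _]addr0; apply: range_in_comb => //; exact: range_in0. Qed.

Lemma range_in_scale P c x : c != 0 -> range_in P (c *: x) -> range_in P x.
Proof. by move=> c0 /(@range_inZ P c^-1); rewrite scalerA mulVf // scale1r. Qed.

Lemma range_in_sum P (J : Type) (s : seq J) (x : J -> V -> V) :
  (forall j, range_in P (x j)) -> range_in P (\sum_(j <- s) x j).
Proof.
move=> h; elim/big_ind: _ => [|y z hy hz|//]; first exact: range_in0.
by rewrite -[y]scale1r; apply: range_in_comb.
Qed.

Lemma kills_lt_ext u a x : linear a -> kills_lt u a ->
  (forall i, co x i != 0 -> (i < u)%O) -> a x = 0.
Proof.
move=> la ha hx; rewrite (bcoord_sum bB x) linear_fun_sum // big1 // => i _.
by rewrite linear_funZ //; have [->|/hx/ha ->] := eqVneq (co x i) 0; rewrite ?scale0r ?scaler0.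
Qed.

(** Since [y (b u)] lies in V(u), [UT_diag] applies: each diagonal entry is a character of the
    triangular algebra. *)
Lemma diag_comp u x y : UT b x -> UT b y -> diag u (x \o y) = diag u x * diag u y.
Proof.
move=> xU yU; rewrite /diag /= (UT_diag (bB := bB)) // => i.
by have [_] := (UT_bcoord bB y).1 yU; exact.
Qed.

Lemma diag_bigsum u (J : Type) (s : seq J) (x : J -> V -> V) :
  diag u (\sum_(j <- s) x j) = \sum_(j <- s) diag u (x j).
Proof. by rewrite /diag fct_sumE bcoord_bigsum. Qed.

Lemma diag_munit u : diag u (munit u u) = 1.
Proof. by rewrite /diag munit_basis eqxx scale1r bcoord_basis eqxx. Qed.

Lemma munit_range u v : range_in (fun i => (i <= u)%O) (munit u v).
Proof.
move=> x i; rewrite bcoordZ bcoord_basis; case: (eqVneq i u) => [->//|_].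
by rewrite mulr0 eqxx.
Qed.

(** For w < u the components of e_ww have range in V(w), hence are annihilated by [a]. Then the
    components of [a] annihilate e_ww, and so kill [b w]. *)
Lemma kills_lt_graded u : (forall w, (w < u)%O -> graded (range_in (fun i => (i <= w)%O))) ->
  graded (kills_lt u).
Proof.
move=> gw a Aa ha g w wu.
have Ae : A (munit w w) by exact: ideal_munit.
suff h0 : forall h, a \o hc (munit w w) h = 0.
  have /(congr1 (fun f => f (b w))) := left_annihilator gr ideal_linear Aa Ae h0 g.
  by rewrite /= munit_basis eqxx scale1r.
move=> h; apply/funext => x /=; apply: (kills_lt_ext (ideal_linear Aa) ha) => i ci.
by apply: le_lt_trans (wu); apply: (gw w wu _ Ae (@munit_range w w) h x).
Qed.

(** Range in V(<u) means being annihilated on the left by all e_ii with i >= u. These kill V(<u),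
    hence so do their components, and [right_annihilator] passes the relation on to the components
    of [x]. *)
Lemma range_lt_graded u : graded (kills_lt u) -> graded (range_in (fun i => (i < u)%O)).
Proof.
move=> gk x Ax hx g v i; apply: contraNT; rewrite -leNgt => ui.
have Ae : A (munit i i) by exact: ideal_munit.
have ke : kills_lt u (munit i i).
  move=> w wu; rewrite munit_basis; case: eqP => [iw|]; last by rewrite scale0r.
  by have := lt_le_trans wu ui; rewrite iw ltxx.
suff h0 : forall h, hc (munit i i) h \o x = 0.
  have /(congr1 (fun f => f v)) := right_annihilator gr ideal_linear Ae Ax h0 g.
  rewrite /= /munit /rank1 => /eqP.
  by rewrite scaler_eq0 (negbTE (basis_neq0 bB i)) orbF.
move=> h; apply/funext => z /=; apply: (@kills_lt_ext u) => //.
- by apply: ideal_linear; apply: (component_sub gr).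
- exact: gk.
- exact: hx.
Qed.

(** * Inductive step: from range V(<u) to range V(u) *)

Section Step.
Variable u : I.
Hypothesis glt : graded (range_in (fun i => (i < u)%O)).
Local Notation range_lt := (range_in (fun i => (i < u)%O)).
Local Notation range_le := (range_in (fun i => (i <= u)%O)).

Lemma range_lt_comp a x : UT b a -> range_lt x -> range_lt (a \o x).
Proof. by move=> aU hx v i; apply: (UT_lt aU); apply: hx. Qed.

(* A acts on range_le modulo range_lt through the character [diag u]. *)
Lemma range_le_diag a x : A a -> range_le x -> range_lt ((- diag u a) *: x + (a \o x)).
Proof.
move=> Aa hx v i; rewrite fctE /= bcoordP; have aU := ideal_UT Aa.
have [->|iu] := eqVneq i u.
  by rewrite /= (UT_diag aU (hx v)) /diag mulNr addNr eqxx.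
rewrite lt_neqAle iu; apply: contraNT => iu'.
by rewrite (contraNeq (@hx v i)) // (contraNeq (UT_le aU (hx v) (i := i))) // mulr0 addr0.
Qed.

Lemma unit_component : exists h, ~ range_lt (hc (munit u u) h).
Proof.
apply: contrapT => nex.
have Ae : A (munit u u) by exact: ideal_munit.
have [s [_ _ eE]] := component_sum gr Ae.
have /(_ (b u) u) : range_lt (munit u u).
  by rewrite eE; apply: range_in_sum => h; apply: contrapT => nh; apply: nex; exists h.
by rewrite -/(diag u _) diag_munit oner_eq0 ltxx => /(_ isT).
Qed.

(** Modulo range V(<u), a e_uu is [diag u a] times e_uu. In degree h this compares the component of
    e_uu at h with a times its component at g^-1 h. *)
Lemma component_shift g a h : Gm g a -> diag u a != 0 ->
  ~ range_lt (hc (munit u u) h) -> ~ range_lt (hc (munit u u) (g^-1 * h)%g).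
Proof.
move=> Ga da; apply: contra_not => hr.
have Aa := grading_sub gr Ga; have Ae : A (munit u u) by exact: ideal_munit.
have Aae : A (a \o munit u u) by exact: ideal_comp.
have := @glt _ (ideal_comb (- diag u a) Ae Aae) (range_le_diag Aa (@munit_range u u)) h.
rewrite (component_comb gr) // (component_mull gr ideal_linear h Ga Ae) => H.
have := @range_in_comb _ (-1) _ _ (range_lt_comp (ideal_UT Aa) hr) H.
rewrite scaleN1r addrC addrK; apply: range_in_scale.
by rewrite oppr_eq0.
Qed.

(** By repeated shifts e_uu has a nonzero component in every degree g^-n h0. There are finitely many
    such degrees, so two of the powers coincide. *)
Lemma degree_torsion g a : Gm g a -> diag u a != 0 -> exists k, (g ^+ k.+1 = 1)%g.
Proof.
move=> Ga da; have [h0 hh0] := unit_component.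
have Ae : A (munit u u) by exact: ideal_munit.
have [s [us hs _]] := component_sum gr Ae.
have ins n : ((g^-1) ^+ n * h0)%g \in s.
  have : ~ range_lt (hc (munit u u) ((g^-1) ^+ n * h0)%g).
    elim: n => [|n IH]; first by rewrite expg0 mul1g.
    by rewrite expgS -mulgA; apply: (component_shift Ga).
  by apply: contra_notT => /hs ->; exact: range_in0.
pose f (n : 'I_(size s).+1) := ((g^-1) ^+ n * h0)%g.
have : ~~ injectiveb f.
  apply/negP => /injectiveP fi.
  have uf : uniq (codom f) by rewrite map_inj_uniq // enum_uniq.
  have /(uniq_leq_size uf) : {subset codom f <= s} by move=> _ /codomP[n ->]; exact: ins.
  by rewrite size_codom card_ord ltnn.
move=> /injectivePn[n [m nm]] /mulIg.
wlog {nm} nm : n m / (n < m)%N.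
  move=> W E; have := nm; rewrite -val_eqE neq_ltn => /orP[] lt; first exact: (W n m).
  by apply: (W m n).
rewrite -(subnKC (ltnW nm)) expgnDr -[LHS]mulg1 => /mulgI.
rewrite -subnSK //; set k := (m - n.+1)%N => E; exists k.
by rewrite -[RHS]invg1 E expVgn invgK.
Qed.

Lemma diag_inverse_degree g a : Gm g a -> diag u a != 0 ->
  exists a', Gm (g^-1)%g a' /\ diag u a' != 0.
Proof.
move=> Ga da; have [k gk] := degree_torsion Ga da.
pose p n := iter n (fun y => a \o y) a.
have Gp n : Gm (g ^+ n.+1)%g (p n) /\ diag u (p n) != 0.
  elim: n => [|n [IH1 IH2]]; first by rewrite expg1.
  rewrite expgS; split; first exact: (grading_mul gr).
  rewrite /= diag_comp; first by rewrite mulf_neq0.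
    by apply: ideal_UT; apply: (grading_sub gr Ga).
  by apply: ideal_UT; apply: (grading_sub gr IH1).
(* [p n] is the power a^(n+1), so the exponent is 2k+1 = 2(k+1) - 1. It is positive also for k = 0,
   where the exponent k would call for an identity, possibly missing from [A]. *)
exists (p (k + k)%N); have [] := Gp (k + k)%N; suff -> : (g ^+ (k + k).+1 = g^-1)%g by [].
by apply/esym/mulg1_eq; rewrite -expgS -addSn -addnS expgnDr gk mulg1.
Qed.

Definition diag_trace a := diag u (hc a 1%g).

(** For homogeneous x_g only y_(g^-1) contributes in degree 1, on either side, and [diag u] is
    multiplicative with commutative values. *)
Lemma diag_traceC x y : A x -> A y -> diag_trace (x \o y) = diag_trace (y \o x).
Proof.
move=> Ax Ay; have [s [us hs xE]] := component_sum gr Ax.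
have Ac g : A (hc x g) by exact: component_sub.
have Acy g : A (hc x g \o y) by exact: ideal_comp.
have Ayc g : A (y \o hc x g) by exact: ideal_comp.
have -> : x \o y = \sum_(g <- s) (hc x g \o y) by rewrite -comp_suml -xE.
have -> : y \o x = \sum_(g <- s) (y \o hc x g).
  by rewrite -comp_sumr -?xE //; exact: ideal_linear.
rewrite /diag_trace !(component_bigsum gr ideal_comb) // !diag_bigsum.
apply: eq_bigr => g _; have Gg := component_homogeneous gr g Ax.
rewrite (component_mull gr ideal_linear _ Gg Ay) (component_mulr gr _ Gg Ay).
have Ux := ideal_UT (Ac g).
have Uy := ideal_UT (component_sub gr (g^-1)%g Ay).
by rewrite mul1g mulg1 (diag_comp u Ux Uy) (diag_comp u Uy Ux) mulrC.
Qed.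

Lemma diag_component_munit j g : (u < j)%O -> diag u (hc (munit u j) g) = 0.
Proof.
move=> uj; apply/eqP; apply: contraT => nz.
have Aj : A (munit u j) by apply: ideal_munit; exact: ltW.
have Ae : A (munit u u) by exact: ideal_munit.
have [a [Ga da]] := diag_inverse_degree (component_homogeneous gr g Aj) nz.
have Aa := grading_sub gr Ga.
have Aja : A (munit u j \o a) by exact: ideal_comp.
(* With [a] of degree g^-1, the trace of e_uu (e_uj a) = e_uj a is the product of the diagonal
   entries of the component of e_uj at [g] and of [a], both nonzero. The trace of e_uj a e_uu is 0,
   because the entry of [a] at (j, u) lies below the diagonal. *)
have := diag_traceC Ae Aja.
have -> : munit u u \o (munit u j \o a) = munit u j \o a.
  by apply/funext => v; rewrite /munit /rank1 /= !bcoordZ bcoord_basis eqxx mulr1.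
have -> : munit u j \o a \o munit u u = 0.
  apply/funext => v; rewrite /munit /rank1 /= (linear_funZ _ _ (ideal_linear Aa)) bcoordZ.
  have [_ /(_ j u) h] := (UT_bcoord bB a).1 (ideal_UT Aa).
  have -> : co (a (b u)) j = 0.
    by apply/eqP; apply: contraT => /h; rewrite leNgt uj.
  by rewrite mulr0 scale0r.
rewrite /diag_trace (component_mulr gr _ Ga Aj) mul1g invgK diag_comp.
- rewrite (component_homog gr _ (grading0 gr 1%g)) if_same => /eqP.
  by rewrite /diag bcoord0 mulf_eq0 (negbTE nz) (negbTE da).
- by apply: ideal_UT; apply: component_sub.
- exact: ideal_UT.
Qed.

Lemma range_le_graded : graded range_le.
Proof.
move=> x Ax hx g v j; apply: contraNT; rewrite -ltNge => uj.
have Aj : A (munit u j) by apply: ideal_munit; exact: ltW.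
(* Each component of e_uj has zero entry at (u, u), so it sends [x] into range V(<u); the degree hg
   part gives the same for the component of [x]. As e_uj takes values in the line of [b u], the
   product then vanishes. *)
have H : range_lt (munit u j \o hc x g).
  have [s [_ _ jE]] := component_sum gr Aj.
  rewrite jE comp_suml; apply: range_in_sum => h.
  have Gh := component_homogeneous gr h Aj; have Ah := grading_sub gr Gh.
  have := range_le_diag Ah hx; rewrite diag_component_munit // oppr0 scale0r add0r.
  move=> H; have := @glt _ (ideal_comp Ah Ax) H (h * g)%g.
  by rewrite (component_mull gr ideal_linear _ Gh Ax) mulKg.
have := H v u; rewrite /= /munit /rank1 bcoordZ bcoord_basis eqxx mulr1 ltxx.
by case: eqP => // _ /(_ isT).
Qed.

(** Let y be a component of e_uu, of degree h, not of range V(<u). Then a y - (diag u a) y has range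
    V(<u). If g is not 1, a y has degree gh, different from h, and the degree h part puts y itself
    there. *)
Lemma diag_graded g a : Gm g a -> diag u a != 0 -> g = 1%g.
Proof.
move=> Ga da; apply/eqP; apply: contraT => g1.
have [h nh] := unit_component; exfalso; apply: nh.
have Ae : A (munit u u) by exact: ideal_munit.
set y := hc _ h; have Gy : Gm h y by exact: (component_homogeneous gr h Ae).
have Ay := grading_sub gr Gy; have Aa := grading_sub gr Ga.
have hy : range_le y by exact: (@range_le_graded _ Ae (@munit_range u u) h).
have := @glt _ (ideal_comb (- diag u a) Ay (ideal_comp Aa Ay)) (range_le_diag Aa hy) h.
rewrite (component_comb gr) //; last exact: ideal_comp.
rewrite (component_homog gr _ Gy) eqxx (component_homog gr _ (grading_mul gr Ga Gy)).
rewrite eq_sym -[X in _ == X]mul1g (inj_eq (@mulIg _ h)) (negbTE g1) addr0.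
by apply: range_in_scale; rewrite oppr_eq0.
Qed.

End Step.

Lemma flag_graded u : graded (range_in (fun i => (i <= u)%O)) /\
  forall g a, Gm g a -> diag u a != 0 -> g = 1%g.
Proof.
elim/(well_ordered_ind I_wo): u => u IH.
have gk : graded (kills_lt u) by apply: kills_lt_graded => w /IH[].
by split; [apply: range_le_graded|apply: diag_graded]; apply: range_lt_graded.
Qed.

Lemma kills_graded u : graded (kills_lt u).
Proof. by apply: kills_lt_graded => w _; have [] := flag_graded w. Qed.

End Characters.

(** * Inverting triangular maps with nonzero diagonal *)

Section TriangularInverse.
Local Open Scope ring_scope.
Variables (F : fieldType) (V : lmodType F) (d : Order.disp_t) (I : orderType d).
Variable b : I -> V.
Hypotheses (I_wo : well_ordered I) (bB : is_basis b).
Local Notation co := (bcoord bB).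

(** Leading coordinates are multiplied by nonzero diagonal entries, which gives injectivity.
    Preimages are built by well-founded induction on the leading index. *)
Lemma UT_inverse (T : V -> V) : UT b T -> (forall u, diag bB u T != 0) ->
  exists S, [/\ UT b S, cancel T S & cancel S T].
Proof.
move=> TU T1; have lT := UT_linear TU.
have Tinj x : T x = 0 -> x = 0.
  move=> Tx; apply/eqP; apply: contraT => /(leading_index bB)[i [ci imax]].
  have := UT_diag TU imax; rewrite Tx bcoord0 => /esym/eqP.
  by rewrite mulf_eq0 (negbTE ci) (negbTE (T1 i)).
have Tinj' : injective T.
  by move=> x y xy; apply/eqP; rewrite -subr_eq0; apply/eqP/Tinj; rewrite linear_funB // xy subrr.
have Tsurj u : forall y, (forall i, co y i != 0 -> (i <= u)%O) ->
    exists2 x, (forall i, co x i != 0 -> (i <= u)%O) & T x = y.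
  elim/(well_ordered_ind I_wo): u => u IH y hy.
  have hTb : forall i, co (T (b u)) i != 0 -> (i <= u)%O.
    by move=> i; have [_] := (UT_bcoord bB T).1 TU; exact.
  (* [c] cancels the coordinate of [y] at [u], so the remainder is 0 or has a leading index smaller
     than [u]. *)
  set c := co y u / diag bB u T; pose r := y - c *: T (b u).
  have hr i : co r i != 0 -> (i < u)%O.
    rewrite /r bcoordB bcoordZ; have [->|iu] := eqVneq i u.
      by rewrite -/(diag bB u T) divfK // subrr eqxx.
    rewrite lt_neqAle iu /=; apply: contraNT => niu.
    by rewrite (contraNeq (hy i)) // (contraNeq (hTb i)) // mulr0 subrr.
  have [x hx Tx] : exists2 x, (forall i, co x i != 0 -> (i <= u)%O) & T x = r.
    have [r0|/(leading_index bB)[k [ck kmax]]] := eqVneq r 0.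
      by exists 0; rewrite ?linear_fun0 // => i; rewrite bcoord0 eqxx.
    have [x hx Tx] := IH k (hr k ck) r kmax.
    by exists x => // i /hx ik; apply: le_trans ik (ltW (hr k ck)).
  exists (c *: b u + x); last by rewrite lT Tx /r addrC subrK.
  move=> i; rewrite bcoordP bcoord_basis; apply: contraNT => ui.
  rewrite (contraNeq (hx i)) // addr0; case: (eqVneq i u) ui => [->|_ _]; last by rewrite mulr0.
  by rewrite lexx.
have Tonto y : exists x, T x = y.
  have [->|/(leading_index bB)[k [_ kmax]]] := eqVneq y 0.
    by exists 0; rewrite linear_fun0.
  by have [x _ Tx] := Tsurj k y kmax; exists x.
have [S TS] := choice Tonto.
have ST : cancel T S by move=> x; apply: Tinj'; rewrite TS.
exists S; split => //; apply/(UT_bcoord bB); split.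
  by move=> c x y; apply: Tinj'; rewrite lT !TS.
move=> i j; have [|x hx Tx] := Tsurj j (b j).
  by move=> k; rewrite bcoord_basis; case: (eqVneq k j) => [->//|_]; rewrite eqxx.
by rewrite -Tx ST; exact: hx.
Qed.

End TriangularInverse.

(** * Homogeneity read off the matrix entries *)

Section HomogeneousDegree.
Local Open Scope ring_scope.
Variables (F : fieldType) (V : lmodType F) (d : Order.disp_t) (I : orderType d).
Variables (b : I -> V) (G : groupType).
Hypothesis bB : is_basis b.

(** An entrywise condition also makes sense for maps with infinitely many nonzero entries, and it is
    preserved by pointwise limits. *)
Definition homdeg (eta : I -> G) (g : G) (a : V -> V) :=
  forall i j, bcoord bB (a (b j)) i != 0 -> ((eta i)^-1 * eta j)%g = g.

End HomogeneousDegree.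

(** * A basis and functionals adapted to the grading *)

Section HomogeneousBasis.
Local Open Scope ring_scope.
Variables (F : fieldType) (V : lmodType F) (d : Order.disp_t) (I : orderType d).
Variables (b : I -> V) (G : groupType).
Hypotheses (I_wo : well_ordered I) (bB : is_basis b).
Variables (A : set (V -> V)) (Gm : G -> set (V -> V)).
Hypotheses (idA : UT_ideal bB A) (gr : is_grading A Gm).
Local Notation co := (bcoord bB).
Local Notation hc := (component Gm).
Local Notation Acomb := (ideal_comb idA).
Local Notation Alin := (ideal_linear idA).

Lemma unit_component1 u : exists a, [/\ Gm 1%g a, range_in bB (fun i => (i <= u)%O) a,
  kills_lt b u a & diag bB u a = 1].
Proof.
have Ae : A (munit bB u u) by exact: ideal_munit.
have [gle gdiag] := flag_graded I_wo idA gr u.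
exists (hc (munit bB u u) 1%g); split.
- exact: (component_homogeneous gr).
- exact: (@gle _ Ae (@munit_range _ _ _ _ _ bB u u) 1%g).
- apply: (kills_graded I_wo idA gr) => // w wu.
  by rewrite munit_basis gt_eqF // scale0r.
have [s [us hs eE]] := component_sum gr Ae.
have := diag_munit bB u; rewrite {1}eE diag_bigsum => E.
have h1 g : g != 1%g -> diag bB u (hc (munit bB u u) g) = 0.
  move=> g1; apply/eqP; apply: contraT => /gdiag h; case/eqP: g1; apply: h.
  exact: (component_homogeneous gr).
move: E; have [s1|s1] := boolP (1%g \in s).
  by rewrite (bigD1_seq 1%g) //= big1 ?addr0.
rewrite big_seq big1 => [/esym/eqP|g gs]; first by rewrite oner_eq0.
by apply: h1; apply: contraNneq s1 => <-.
Qed.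

Lemma homogeneous_idempotents : exists (v : I -> V) (c : I -> V -> F), forall u,
  [/\ scalar (c u), co (v u) u = 1, forall i, co (v u) i != 0 -> (i <= u)%O,
      forall w, (w < u)%O -> c u (b w) = 0 & c u (v u) = 1 /\ Gm 1%g (rank1 (v u) (c u))].
Proof.
have [a aP] := choice unit_component1.
exists (fun u => a u (b u)), (fun u x => co (a u x) u) => u.
have [G1 hr hk hd] := aP u; have Aa := grading_sub gr G1.
have la := Alin Aa; have Ua := ideal_UT idA Aa.
split.
- by move=> c x y; rewrite la bcoordP.
- exact: hd.
- exact: hr.
- by move=> w /hk ->; rewrite bcoord0.
split; first by rewrite (UT_diag Ua (hr _)) -/(diag bB u (a u)) hd mulr1.
(* [a u x] differs from its [b u] term by a vector of V(<u), which [a u] kills. So the square of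
   [a u] has rank one. *)
suff -> : rank1 (a u (b u)) (fun x => co (a u x) u) = a u \o a u.
  by rewrite -[1%g]mulg1; apply: (grading_mul gr).
apply/funext => x; rewrite /rank1 /= -linear_funZ //; apply/eqP.
rewrite eq_sym -subr_eq0 -linear_funB //; apply/eqP; apply: (kills_lt_ext la hk) => i.
rewrite bcoordB bcoordZ bcoord_basis; have [->|iu] := eqVneq i u.
  by rewrite mulr1 subrr eqxx.
by rewrite mulr0 subr0 lt_neqAle iu; exact: hr.
Qed.

Variables (v : I -> V) (c : I -> V -> F).
Hypothesis cS : forall u, scalar (c u).
Hypothesis vu : forall u, co (v u) u = 1.
Hypothesis vle : forall u i, co (v u) i != 0 -> (i <= u)%O.
Hypothesis clt : forall u w, (w < u)%O -> c u (b w) = 0.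
Hypothesis cv : forall u, c u (v u) = 1.
Hypothesis hom1 : forall u, Gm 1%g (rank1 (v u) (c u)).

Lemma ideal_vc w u : (w <= u)%O -> A (rank1 (v w) (c u)).
Proof.
move=> wu; apply: (UT_ideal_rank1 idA) => // i j /vle iw cj.
by apply: le_trans iw (le_trans wu _); rewrite leNgt; apply: contraNN cj => /clt ->.
Qed.

Lemma v_neq0 u : v u != 0.
Proof. by apply/eqP => v0; have /eqP := vu u; rewrite v0 bcoord0 eq_sym oner_eq0. Qed.

Lemma vc_neq0 w u : rank1 (v w) (c u) != 0.
Proof.
apply/eqP => /(congr1 (fun f => f (v u))); rewrite /rank1 cv scale1r => /eqP.
by rewrite (negbTE (v_neq0 w)).
Qed.

Lemma scalarZ (phi : V -> F) a x : scalar phi -> phi (a *: x) = a * phi x.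
Proof. by move=> lp; rewrite -[_ *: _]addr0 lp scalar0 // addr0. Qed.

Lemma vc_homogeneous w u : (w <= u)%O -> exists g, Gm g (rank1 (v w) (c u)).
Proof.
move=> wu; have AR := ideal_vc wu; set R := rank1 (v w) (c u) in AR *.
have RE : R = rank1 (v w) (c w) \o (R \o rank1 (v u) (c u)).
  apply/funext => x; rewrite /R /rank1 /= !scalarZ // !cv !mulr1 //.
(* The rank-one idempotents at [w] and [u] have degree 1, so each component of R equals its own
   compression between them, a multiple of R. *)
have hE h : hc R h = (c w (hc R h (v u))) *: R.
  rewrite {1}RE; have A1 := grading_sub gr (hom1 u).
  have ARu : A (R \o rank1 (v u) (c u)) by exact: (ideal_comp idA).
  rewrite (component_mull gr Alin h (hom1 w) ARu) (component_mulr gr _ (hom1 u) AR).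
  rewrite invg1 mul1g mulg1; apply/funext => x; rewrite /rank1 /= fctE.
  rewrite linear_funZ; last by apply: Alin; apply: component_sub.
  by rewrite scalarZ // scalerA mulrC.
have [s [_ _ sE]] := component_sum gr AR.
have [h hn] : exists h, c w (hc R h (v u)) != 0.
  apply: contrapT => nex; have /eqP := vc_neq0 w u; apply; rewrite -/R sE big1 // => h _.
  rewrite hE; have [->|n0] := eqVneq (c w (hc R h (v u))) 0; first by rewrite scale0r.
  by case: nex; exists h.
exists h; have := component_homogeneous gr h AR; rewrite hE => /(gradingZ gr (c w (hc R h (v u)))^-1).
by rewrite scalerA mulVf // scale1r.
Qed.

Lemma vc_degree : exists eta : I -> G,
  forall w u, (w <= u)%O -> Gm ((eta w)^-1 * eta u)%g (rank1 (v w) (c u)).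
Proof.
have [[i0 _]|noI] := pselect (exists i : I, True); last first.
  by exists (fun=> 1%g) => w; case: noI; exists w.
have [o omin] := well_ordered_min I_wo i0.
have [eta etaP] := choice (fun u => vc_homogeneous (omin u)).
(* With o the least index, [eta u] is the degree of v_o (x) c_u. The product of v_o (x) c_w and v_w
   (x) c_u is v_o (x) c_u, hence eta(w) g = eta(u). *)
exists eta => w u wu; have [g Gg] := vc_homogeneous wu.
suff -> : ((eta w)^-1 * eta u = g)%g by [].
have E : rank1 (v o) (c u) = rank1 (v o) (c w) \o rank1 (v w) (c u).
  by apply/funext => x; rewrite /rank1 /= scalarZ // cv mulr1.
have := grading_mul gr (etaP w) Gg; rewrite -E => H.
by rewrite -(grading_degree_unique gr H (etaP u) (vc_neq0 o u)) mulKg.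
Qed.

Variable eta : I -> G.
Hypothesis etaP : forall w u, (w <= u)%O -> Gm ((eta w)^-1 * eta u)%g (rank1 (v w) (c u)).
Variables T S : V -> V.
Hypotheses (TU : UT b T) (SU : UT b S) (TK : cancel T S) (SK : cancel S T).
Hypothesis Tb : forall u, T (b u) = v u.

Lemma ideal_conj a : A a -> A (S \o a \o T).
Proof. by move=> Aa; apply: (UT_ideal_mul idA). Qed.

(** Multiplying [a] by the degree 1 idempotent v_j (x) c_j isolates column j: the result, of degree
    [g], is a combination of the v_w (x) c_j, each of known degree. Terms of any other degree must
    vanish. *)
Lemma conj_homdeg g a : Gm g a -> homdeg bB eta g (S \o a \o T).
Proof.
move=> Ga i j; rewrite /= Tb; set z := S (a (v j)) => zi.
have Aa := grading_sub gr Ga; have lT := UT_linear TU.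
have zle k : co z k != 0 -> (k <= j)%O.
  have [_] := (UT_bcoord bB _).1 (ideal_UT idA (ideal_conj Aa)).
  by move=> /(_ k j); rewrite /= Tb.
apply/eqP; apply: contraT => neg; set h := ((eta i)^-1 * eta j)%g in neg.
pose y w := co z w *: rank1 (v w) (c j).
have yE w : A (y w) /\ hc (y w) h = if ((eta w)^-1 * eta j == h)%g then y w else 0.
  rewrite /y; have [->|/zle wj] := eqVneq (co z w) 0.
    rewrite scale0r if_same; split; first exact: (grading_mem0 gr).
    by rewrite (component_homog gr _ (grading0 gr 1%g)) if_same.
  split; first by apply: (grading_sub gr); apply: (gradingZ gr); exact: etaP wj.
  by rewrite (component_homog gr _ (gradingZ gr (co z w) (etaP wj))) eq_sym.
have aE : a \o rank1 (v j) (c j) = \sum_(w <- supp bB z) y w.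
  apply/funext => x; rewrite fct_sumE /rank1 /= linear_funZ; last exact: Alin Aa.
  rewrite -[a (v j)]SK -/z {1}(bcoord_sum bB z) linear_fun_sum // scaler_sumr.
  apply: eq_bigr => w _; rewrite linear_funZ // Tb /y fctE /= /rank1.
  by rewrite !scalerA mulrC.
have Gaj : Gm g (a \o rank1 (v j) (c j)) by rewrite -[g]mulg1; apply: (grading_mul gr).
have := component_homog gr h Gaj; rewrite (negbTE neg) {1}aE.
rewrite (component_bigsum gr Acomb); last by move=> w; have [] := yE w.
under eq_bigr => w _ do rewrite (yE w).2.
move=> /(congr1 (fun f => S (f (v j)))); rewrite fct_sumE.
have lS := UT_linear SU; rewrite linear_fun_sum // (linear_fun0 lS).
(* Evaluated at [v j] and moved back by [S], the degree h component is the part of [z] on the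
   indices of degree h; its coordinate at [i] is that of [z]. *)
pose f w := if ((eta w)^-1 * eta j == h)%g then co z w else 0.
have -> : \sum_(w <- supp bB z) S ((if ((eta w)^-1 * eta j == h)%g then y w else 0) (v j)) =
    \sum_(w <- supp bB z) f w *: b w.
  apply: eq_bigr => w _; rewrite /f; case: ifP => _; last by rewrite scale0r linear_fun0.
  by rewrite /y fctE /rank1 cv scale1r linear_funZ // -Tb TK.
have fe : expansion b (\sum_(w <- supp bB z) f w *: b w) (supp bB z, f).
  split => //=; first exact: supp_uniq.
  by move=> w /bcoord_supp; rewrite /f => ->; rewrite if_same.
move=> /(congr1 (fun x => co x i)); rewrite (expansion_bcoord bB fe) /= /f eqxx bcoord0.
by move=> /eqP; rewrite (negbTE zi).
Qed.

Lemma finitely_many_degrees : exists s : seq G, forall u, eta u \in s.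
Proof.
have [[i0 _]|noI] := pselect (exists i : I, True); last first.
  by exists [::] => w; case: noI; exists w.
have [o omin] := well_ordered_min I_wo i0.
have lS := UT_linear SU.
pose phi x : F := lin_ext bB (fun=> 1 : F^o) (S x).
have phiS : scalar phi by move=> k x y; rewrite /phi lS lin_ext_linear.
have phiv u : phi (v u) = 1 by rewrite /phi -Tb TK lin_ext_basis.
(* As [o] is least, [v o] is supported at [o] alone and any functional is allowed. In the new basis
   the map has entry 1 at every (o, u), and some component must supply it. *)
have Aa : A (rank1 (v o) phi).
  apply: (UT_ideal_rank1 idA) => // i j /vle io _.
  exact: le_trans io (omin j).
have [s [_ _ sE]] := component_sum gr Aa.
exists [seq (eta o * g)%g | g <- s] => u.
have : co (S (rank1 (v o) phi (v u))) o = 1.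
  by rewrite /rank1 phiv scale1r -Tb TK bcoord_basis eqxx.
rewrite {1}sE fct_sumE linear_fun_sum // bcoord_bigsum => E.
have [g gs gn] : exists2 g, g \in s & co (S (hc (rank1 (v o) phi) g (v u))) o != 0.
  apply: contrapT => nex; have /eqP := E; rewrite big_seq big1 ?[0 == _]eq_sym ?oner_eq0 // => g gs.
  by apply/eqP; apply: contraT => gn; case: nex; exists g.
have := conj_homdeg (component_homogeneous gr g Aa) (i := o) (j := u).
by rewrite /= Tb => /(_ gn) gE; apply/mapP; exists g; rewrite -?gE ?mulVKg ?gE.
Qed.

End HomogeneousBasis.

(** * Conjugating an arbitrary grading to matrix form *)

Section Structure.
Local Open Scope ring_scope.
Variables (F : fieldType) (V : lmodType F) (d : Order.disp_t) (I : orderType d).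
Variables (b : I -> V) (G : groupType).
Hypotheses (I_wo : well_ordered I) (bB : is_basis b).
Variables (A : set (V -> V)) (Gm : G -> set (V -> V)).
Hypotheses (idA : UT_ideal bB A) (gr : is_grading A Gm).

Lemma grading_conj_homdeg : exists (eta : I -> G) (T S : V -> V),
  [/\ UT b T, UT b S, cancel T S, cancel S T &
    (exists s : seq G, forall u, eta u \in s) /\
    forall g a, Gm g a -> homdeg bB eta g (S \o a \o T)].
Proof.
have [v [c vc]] := homogeneous_idempotents I_wo idA gr.
have cS u : scalar (c u) by have [] := vc u.
have vu u : bcoord bB (v u) u = 1 by have [] := vc u.
have vle u i : bcoord bB (v u) i != 0 -> (i <= u)%O by have [_ _ + _ _] := vc u; exact.
have clt u w : (w < u)%O -> c u (b w) = 0 by have [_ _ _ + _] := vc u; exact.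
have cv u : c u (v u) = 1 by have [_ _ _ _ []] := vc u.
have hom1 u : Gm 1%g (rank1 (v u) (c u)) by have [_ _ _ _ []] := vc u.
have [eta etaP] := vc_degree I_wo idA gr cS vu vle clt cv hom1.
pose T := lin_ext bB v.
have Tb u : T (b u) = v u by rewrite /T lin_ext_basis.
have TU : UT b T.
  apply/(UT_bcoord bB); split; first exact: lin_ext_linear.
  by move=> i j; rewrite Tb; exact: vle.
have [|S [SU TK SK]] := UT_inverse I_wo (bB := bB) TU.
  by move=> u; rewrite /diag Tb vu oner_eq0.
exists eta, T, S; split => //; split.
  exact: (finitely_many_degrees I_wo idA gr vle cv hom1 etaP TU SU TK SK Tb).
by move=> g a; exact: (conj_homdeg idA gr cv hom1 etaP TU SU TK SK Tb).
Qed.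

End Structure.

(** * Elementary gradings and their pointwise closures *)

Section ElementaryGradings.
Local Open Scope ring_scope.
Variables (F : fieldType) (V : lmodType F) (d : Order.disp_t) (I : orderType d).
Variables (b : I -> V) (G : groupType).
Hypothesis bB : is_basis b.
Local Notation co := (bcoord bB).
Implicit Types (eta : I -> G) (g : G) (a : V -> V).

Lemma bcoord_apply a x i : linear a -> co (a x) i != 0 ->
  exists2 k, co x k != 0 & co (a (b k)) i != 0.
Proof.
move=> la; rewrite {1}(bcoord_sum bB x) linear_fun_sum // bcoord_bigsum => nz.
apply: contrapT => nex; case/eqP: nz; rewrite big1 // => k _.
rewrite linear_funZ // bcoordZ; apply/eqP; apply: contraT; rewrite mulf_eq0 negb_or.
by case/andP => xk ak; case: nex; exists k.
Qed.

Lemma entry_neq0 a : linear a -> a != 0 -> exists i j, co (a (b j)) i != 0.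
Proof.
move=> la a0; apply: contrapT => nex; case/eqP: a0.
apply: (linear_basis_ext bB) => //; first exact: linear_fct0.
move=> j; apply: (bcoord_inj (bB := bB)) => i; rewrite bcoord0; apply/eqP.
by apply: contraT => nz; case: nex; exists i, j.
Qed.

Lemma homdeg_comb eta g c x y :
  homdeg bB eta g x -> homdeg bB eta g y -> homdeg bB eta g (c *: x + y).
Proof.
move=> hx hy i j; have [//|ne] := eqVneq ((eta i)^-1 * eta j)%g g.
rewrite fctE /= bcoordP.
have -> : co (x (b j)) i = 0 by apply/eqP; apply: contraT => /hx/eqP; rewrite (negbTE ne).
have -> : co (y (b j)) i = 0 by apply/eqP; apply: contraT => /hy/eqP; rewrite (negbTE ne).
by rewrite mulr0 addr0 eqxx.
Qed.

Lemma homdeg0 eta g : homdeg bB eta g 0.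
Proof. by move=> i j; rewrite bcoord0 eqxx. Qed.

Lemma homdeg_comp eta g h x y : linear x ->
  homdeg bB eta g x -> homdeg bB eta h y -> homdeg bB eta (g * h)%g (x \o y).
Proof.
move=> lx hx hy i j /= /(bcoord_apply lx)[k /hy <- /hx <-].
by rewrite -mulgA mulVKg.
Qed.

(** Each position (i, j) has exactly one degree, so an entry of the sum comes from a single
    summand. *)
Lemma homdeg_direct eta (s : seq G) (x : G -> V -> V) : uniq s ->
  (forall g, linear (x g) /\ homdeg bB eta g (x g)) -> \sum_(g <- s) x g = 0 ->
  {in s, forall g, x g = 0}.
Proof.
move=> us hx x0 g gs; apply/eqP; apply: contraT.
have [lg hg] := hx g => /(entry_neq0 lg)[i [j nz]].
have := congr1 (fun f => co (f (b j)) i) x0.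
rewrite fct_sumE bcoord_bigsum bcoord0 (bigD1_seq g) //= big1 ?addr0 => [/eqP|h hg'].
  by rewrite (negbTE nz).
apply/eqP; apply: contraT => /(hx h).2; rewrite (hg i j nz) => gh.
by rewrite gh eqxx in hg'.
Qed.

Lemma ideal0 (A : set (V -> V)) : UT_ideal bB A -> A 0.
Proof.
move=> idA; have := UT_ideal_rank1 idA (w := 0) (phi := fun=> 0).
have -> : rank1 0 (fun=> 0) = 0 :> (V -> V) by apply/funext => x; rewrite /rank1 scale0r.
by apply; [move=> c x y; rewrite mulr0 addr0|move=> i j; rewrite bcoord0 eqxx].
Qed.

Lemma homdeg_munit eta u v : homdeg bB eta ((eta u)^-1 * eta v)%g (munit bB u v).
Proof.
move=> i j; rewrite munit_basis bcoordZ bcoord_basis.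
case: (eqVneq v j) => [->|_]; last by rewrite mul0r eqxx.
by case: (eqVneq i u) => [->|_]; last by rewrite mulr0 eqxx.
Qed.

Lemma munit_UT u v : (u <= v)%O -> UT b (munit bB u v).
Proof. exact: (ideal_munit (UT_UT_ideal bB)). Qed.

Lemma elementary_grading_homdeg eta g a :
  elementary_grading b eta g a -> UT b a /\ homdeg bB eta g a.
Proof.
move: a; apply: lin_span_min => [|c x y [xU hx] [yU hy]|_ [u [v [uv <- ->]]]].
- by split; [exact: ideal0 (UT_UT_ideal bB)|exact: homdeg0].
- by split; [exact: (UT_comb bB)|exact: homdeg_comb].
- by rewrite (matrix_unitE bB); split; [exact: munit_UT|exact: homdeg_munit].
Qed.

(** An entry depends on one value of the map, so limits keep the degree condition. Conversely a map
    satisfying it is approximated by finite combinations of matrix units of that degree. *)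
Lemma induced_homdeg (A : set (V -> V)) eta g : UT_ideal bB A ->
  induced_grading A (elementary_grading b eta) g = [set a | A a /\ homdeg bB eta g a].
Proof.
move=> idA; apply/seteqP; split => a.
  move=> [/closure_ptwsP ca Aa]; split => // i j.
  have [t /elementary_grading_homdeg[_ ht] ta] := ca [:: b j].
  by rewrite -ta ?mem_head //; exact: ht.
move=> [Aa ha]; split => //; apply/closure_ptwsP => s.
have la := ideal_linear idA Aa.
pose r := undup (flatten [seq supp bB x | x <- s]).
(* The approximation is [a] after the projection onto the finitely many basis vectors that occur in
   [s]. *)
exists (\sum_(v <- r) (a \o munit bB v v)); last first.
  move=> x xs; rewrite fct_sumE {2}(bcoord_sum bB x) linear_fun_sum //.
  rewrite (big_supp (s := supp bB x) (r := r)) ?supp_uniq ?undup_uniq //.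
  + by move=> v /bcoord_supp ->; rewrite scale0r linear_fun0.
  + move=> v; rewrite mem_undup => vr; rewrite bcoord_supp ?scale0r ?linear_fun0 //.
    by apply: contra vr => vx; apply/flattenP; exists (supp bB x) => //; apply: map_f.
have span0 : elementary_grading b eta g 0 by exact: lin_span0.
have spanD c x y : elementary_grading b eta g x -> elementary_grading b eta g y ->
    elementary_grading b eta g (c *: x + y) by exact: lin_span_linear.
elim/big_ind: _ => // [x y hx hy|v _]; first by rewrite -[x]scale1r; apply: spanD.
have -> : a \o munit bB v v = \sum_(w <- supp bB (a (b v))) co (a (b v)) w *: munit bB w v.
  apply/funext => x; rewrite fct_sumE /= /munit /rank1 linear_funZ //.
  rewrite {1}(bcoord_sum bB (a (b v))) scaler_sumr; apply: eq_bigr => w _.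
  by rewrite fctE !scalerA mulrC.
elim/big_ind: _ => // [x y hx hy|w _]; first by rewrite -[x]scale1r; apply: spanD.
have [->|nz] := eqVneq (co (a (b v)) w) 0; first by rewrite scale0r.
rewrite -[_ *: _]addr0; apply: spanD => //; apply: sub_lin_span.
exists w, v; split; [|exact: ha|by rewrite (matrix_unitE bB)].
by have [_] := (UT_bcoord bB a).1 (ideal_UT idA Aa); apply.
Qed.

Lemma homdeg_grading (A : set (V -> V)) eta : UT_ideal bB A ->
  (forall a, A a -> exists (s : seq G) (x : G -> V -> V),
    (forall g, A (x g) /\ homdeg bB eta g (x g)) /\ a = \sum_(g <- s) x g) ->
  is_grading A (fun g => [set a | A a /\ homdeg bB eta g a]).
Proof.
move=> idA A_sum; split.
- move=> g; split=> [|c x y]; rewrite !inE.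
    by split; [exact: ideal0 idA|exact: homdeg0].
  by move=> [Ax hx] [Ay hy]; split; [exact: (ideal_comb idA)|exact: homdeg_comb].
- by move=> g a [].
- exact: A_sum.
- move=> s x us hx; apply: homdeg_direct => // g; have [Ag hg] := hx g.
  exact: (conj (ideal_linear idA Ag) hg).
- move=> g h x y [Ax hx] [Ay hy]; split; first exact: (ideal_comp idA).
  by apply: homdeg_comp => //; exact: (ideal_linear idA).
Qed.
End ElementaryGradings.

(** * Every grading is isomorphic to an induced elementary one *)

Section Existence.
Local Open Scope ring_scope.
Variables (F : fieldType) (V : lmodType F) (d : Order.disp_t) (I : orderType d).
Variables (b : I -> V) (G : groupType).
Hypothesis bB : is_basis b.
Local Notation co := (bcoord bB).

Lemma elementary_grading_is_grading (eta : I -> G) :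
  is_grading (UTarrow b) (elementary_grading b eta).
Proof.
have sub g : elementary_grading b eta g `<=` UTarrow b.
  by apply: lin_span_mono => _ [u [v [uv _ ->]]]; exists u, v.
split => //.
- by move=> g; exact: lin_span_submod.
- move=> a [n [c [y [/choice[u] /choice[v] yP ->]]]].
  pose deg i := ((eta (u i))^-1 * eta (v i))%g.
  (* The terms are grouped by degree, each degree being listed once. *)
  exists (undup [seq deg i | i <- enum 'I_n]), (fun g => \sum_(i | deg i == g) c i *: y i).
  split=> [g|].
    elim/big_ind: _ => [|x z hx hz|i /eqP ig]; first exact: lin_span0.
      by rewrite -[x]scale1r; apply: lin_span_linear.
    rewrite -[_ *: _]addr0; apply: lin_span_linear; last exact: lin_span0.
    by have [uv yE] := yP i; apply: sub_lin_span; exists (u i), (v i).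
  rewrite (exchange_big_dep predT) //=; apply: eq_bigr => i _.
  under eq_bigl do rewrite eq_sym.
  rewrite -big_filter filter_pred1_uniq ?undup_uniq ?big_seq1 //.
  by rewrite mem_undup map_f // mem_enum.
- move=> s x us hx; apply: (homdeg_direct (bB := bB) (eta := eta)) => // g.
  by have [/UT_linear] := elementary_grading_homdeg bB (hx g).
move=> g h x y gx hy; pose W := elementary_grading b eta (g * h)%g.
have W0 : W 0 by exact: lin_span0.
have Wl c p q : W p -> W q -> W (c *: p + q) by exact: lin_span_linear.
have lx := UT_linear (elementary_grading_homdeg bB gx).1.
(* Span induction, first on the right factor and then on the left, reduces to products of matrix
   units. *)
suff : elementary_grading b eta h `<=` [set y | W (x \o y)] by apply.
apply: lin_span_min => /=.
- by have -> : x \o (0 : V -> V) = 0 :> (V -> V) by apply/funext => z /=; rewrite linear_fun0.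
- move=> c p q; have -> : x \o (c *: p + q) = c *: (x \o p) + (x \o q).
    by apply/funext => z /=; rewrite !fctE lx.
  exact: Wl.
move=> _ [u [v [uv uvh ->]]] /=; 
suff : elementary_grading b eta g `<=` [set z : V -> V | W (z \o matrix_unit b u v)] by apply.
apply: lin_span_min => /=.
- by have -> : (0 : V -> V) \o matrix_unit b u v = 0 :> (V -> V) by apply/funext.
- move=> c p q; have -> : (c *: p + q) \o matrix_unit b u v =
     c *: (p \o matrix_unit b u v) + (q \o matrix_unit b u v) by apply/funext.
  exact: Wl.
move=> _ [w [t [wt wtg ->]]] /=.
have -> : matrix_unit b w t \o matrix_unit b u v = (u == t)%:R *: matrix_unit b w v.
  apply/funext => z; rewrite !(matrix_unitE bB) /rank1 /= fctE bcoordZ bcoord_basis.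
  by rewrite scalerA mulrC eq_sym.
have [ut|_] := eqVneq u t; last by rewrite scale0r.
rewrite scale1r; apply: sub_lin_span; exists w, v; split => //.
  by rewrite -ut in wt; apply: le_trans wt uv.
by rewrite -wtg -uvh ut -mulgA mulVKg.
Qed.

Lemma homdeg_degree (eta : I -> G) (s : seq G) g (a : V -> V) :
  (forall u, eta u \in s) -> linear a -> homdeg bB eta g a -> a != 0 ->
  g \in [seq (g^-1 * h)%g | g <- s, h <- s].
Proof.
move=> hs la ha a0; have [i [j nz]] := entry_neq0 bB la a0.
by rewrite -(ha i j nz); apply: allpairs_f.
Qed.

Variables (I_wo : well_ordered I) (A : set (V -> V)) (idA : UT_ideal bB A).

(** [A] is an ideal of the triangular algebra, so invertible triangular maps conjugate it into
    itself. *)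
Lemma conj_automorphism S T : UT b S -> UT b T -> cancel T S -> cancel S T ->
  is_automorphism A (fun a => S \o a \o T).
Proof.
move=> SU TU TK SK; have lS := UT_linear SU; split.
- split.
  + by move=> a Aa; apply: (UT_ideal_mul idA).
  + move=> x y _ _ /(congr1 (fun f => T \o f \o S)) E; apply/funext => z.
    by have := congr1 (fun f => f z) E; rewrite /= !SK.
  + move=> a Aa; exists (T \o a \o S); first exact: (UT_ideal_mul idA).
    by apply/funext => z /=; rewrite !TK.
- by move=> c x y _ _; apply/funext => z /=; rewrite !fctE lS.
- by move=> x y _ _; apply/funext => z /=; rewrite SK.
Qed.

Lemma grading_iso_elementary (Gm : G -> set (V -> V)) : is_grading A Gm ->
  exists (eta : I -> G) (s : seq G), [/\ forall u, eta u \in s,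
    finite_support Gm,
    is_grading A (fun g => [set a | A a /\ homdeg bB eta g a]) &
    grading_iso A Gm (fun g => [set a | A a /\ homdeg bB eta g a])].
Proof.
move=> gr; have [eta [T [S [TU SU TK SK [[s hs] hconj]]]]] := grading_conj_homdeg I_wo idA gr.
have lS := UT_linear SU.
have Aconj a : A a -> A (S \o a \o T) by move=> Aa; apply: (UT_ideal_mul idA).
have conjS (J : Type) (r : seq J) (x : J -> V -> V) :
    S \o (\sum_(j <- r) x j) \o T = \sum_(j <- r) (S \o x j \o T).
  by rewrite comp_sumr // comp_suml.
have unconj a : S \o (T \o a \o S) \o T = a by apply/funext => z /=; rewrite !TK.
(* Decompositions for the new grading are transported: decompose T a S in the given one and
   conjugate back. *)
have gr' : is_grading A (fun g => [set a | A a /\ homdeg bB eta g a]).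
  apply: homdeg_grading => // a Aa.
  have Aa' : A (T \o a \o S) by apply: (UT_ideal_mul idA).
  have [r [x [Gx xE]]] := grading_sum gr Aa'.
  exists r, (fun g => S \o x g \o T); split.
    by move=> g; split; [apply: Aconj; exact: (grading_sub gr (Gx g))|exact: hconj].
  by rewrite -conjS -xE unconj.
exists eta, s; split => //.
  apply: (@sub_finite_set _ _ [set` [seq (g^-1 * h)%g | g <- s, h <- s]]).
    move=> g [a Ga a0]; have Aa := grading_sub gr Ga.
    apply: (@homdeg_degree eta s g (S \o a \o T)) => //; last 1 first.
    + apply: contra_neq a0 => /(congr1 (fun f => T \o f \o S)) E; apply/funext => z.
      by have := congr1 (fun f => f z) E; rewrite /= !SK => ->; rewrite (linear_fun0 (UT_linear TU)).
    + by apply: (ideal_linear idA); exact: Aconj.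
    + exact: hconj.
  exact: finite_seq.
exists (fun a => S \o a \o T); first exact: conj_automorphism.
move=> g; apply/seteqP; split => [_ [a Ga <-]|a [Aa ha]].
  by split; [apply: Aconj; exact: (grading_sub gr Ga)|exact: hconj].
have Aa' : A (T \o a \o S) by apply: (UT_ideal_mul idA).
have [Gx [r [ur rz rE]]] := componentP gr Aa'.
(* Conjugating back the components of T a S decomposes [a] in the new grading. By uniqueness the
   part of degree [g] is [a] itself. *)
exists (component Gm (T \o a \o S) g); first exact: Gx.
pose Hm g := [set a | A a /\ homdeg bB eta g a].
have D : decomposition Hm a (fun h => S \o component Gm (T \o a \o S) h \o T).
  split=> [h|]; first by split; [apply: Aconj; exact: (component_sub gr)|exact: hconj].
  exists r; split => //; last by rewrite -conjS -rE unconj.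
  by move=> h /rz ->; apply/funext => z /=; rewrite linear_fun0.
have -> := congr1 (fun f => f g) (esym (componentE gr' D)).
by rewrite (component_homog gr' g (g := g)) ?eqxx.
Qed.

Lemma elementary_grading_finite (eta : I -> G) (s : seq G) :
  (forall u, eta u \in s) -> finite_support (elementary_grading b eta).
Proof.
move=> hs; apply: (@sub_finite_set _ _ [set` [seq (g^-1 * h)%g | g <- s, h <- s]]).
  move=> g [a /(elementary_grading_homdeg bB)[/UT_linear la ha]].
  exact: homdeg_degree.
exact: finite_seq.
Qed.

Theorem grading_classification (Gm : G -> set (V -> V)) : is_grading A Gm ->
  finite_support Gm /\
  exists Gm' : G -> set (V -> V),
    [/\ is_grading A Gm', elementary b Gm', grading_iso A Gm Gm' &
        exists Gm0 : G -> set (V -> V),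
          [/\ is_grading (UTarrow b) Gm0, elementary b Gm0,
              finite_support Gm0 &
              forall g, Gm' g = induced_grading A Gm0 g]].
Proof.
move=> /grading_iso_elementary[eta [s [hs fs gr' iso]]]; split => //.
exists (fun g => [set a | A a /\ homdeg bB eta g a]); split => //.
  exists eta => u v uv /=; rewrite (matrix_unitE bB).
  by split; [exact: ideal_munit|exact: homdeg_munit].
exists (elementary_grading b eta); split.
- exact: elementary_grading_is_grading.
- by exists eta => u v uv; apply: sub_lin_span; exists u, v.
- exact: elementary_grading_finite hs.
- by move=> g; rewrite (induced_homdeg eta g idA).
Qed.

End Existence.

(** * Automorphisms and the recovery of the degree map *)

Section Uniqueness.
Local Open Scope ring_scope.
Variables (F : fieldType) (V : lmodType F) (d : Order.disp_t) (I : orderType d).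
Variables (b : I -> V) (G : groupType).
Hypotheses (I_wo : well_ordered I) (bB : is_basis b).
Variables (A : set (V -> V)) (idA : UT_ideal bB A).
Local Notation co := (bcoord bB).
Local Notation e := (munit bB).

Lemma automorphism0 f : is_automorphism A f -> f 0 = 0.
Proof.
move=> [_ fl _]; have A0 := ideal0 idA.
by have := fl (-1) 0 0 A0 A0; rewrite scaler0 addr0 scaleN1r addNr.
Qed.

Lemma automorphismZ f c x : is_automorphism A f -> A x -> f (c *: x) = c *: f x.
Proof.
move=> fA Ax; have [_ fl _] := fA.
by rewrite -[c *: x]addr0 fl ?(automorphism0 fA) ?addr0 //; exact: ideal0 idA.
Qed.

Lemma automorphism_neq0 f x : is_automorphism A f -> A x -> x != 0 -> f x != 0.
Proof.
move=> fA Ax; apply: contra_neq => fx; have [[_ fi _] _ _] := fA.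
apply: fi; rewrite ?inE //; first exact: ideal0 idA.
by rewrite (automorphism0 fA).
Qed.

Lemma automorphism_inverse f : is_automorphism A f ->
  exists2 f', is_automorphism A f' & forall x, A x -> f (f' x) = x.
Proof.
move=> fA; have [[fF fi fs] fl fM] := fA.
(* Outside [A] the inverse takes the dummy value 0. *)
have /choice[f' f'P] x : exists y, A x -> A y /\ f y = x.
  have [Ax|nAx] := pselect (A x); last by exists 0.
  by have [y Ay yx] := fs x Ax; exists y.
have f'A x : A x -> A (f' x) by move=> /f'P[].
have ff' x : A x -> f (f' x) = x by move=> /f'P[].
have inj x y : A x -> A y -> f x = f y -> x = y.
  by move=> Ax Ay; apply: fi; rewrite inE.
exists f' => //; split.
- split => //.
  + by move=> x y /set_mem Ax /set_mem Ay xy; rewrite -(ff' x) // xy ff'.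
  + move=> x Ax; exists (f x); first exact: fF.
    by apply: inj => //; [apply: f'A; exact: fF|rewrite ff' //; exact: fF].
- move=> c x y Ax Ay; apply: inj.
  + by apply: f'A; exact: (ideal_comb idA).
  + by apply: (ideal_comb idA); apply: f'A.
  + by rewrite fl ?ff' //; [exact: (ideal_comb idA)|exact: f'A|exact: f'A].
- move=> x y Ax Ay; apply: inj.
  + by apply: f'A; exact: (ideal_comp idA).
  + by apply: (ideal_comp idA); apply: f'A.
  + by rewrite fM ?ff' //; [exact: (ideal_comp idA)|exact: f'A|exact: f'A].
Qed.

Lemma munit_comp u v w t : e u v \o e w t = (w == v)%:R *: e u t.
Proof.
apply/funext => x; rewrite /munit /rank1 /= fctE bcoordZ bcoord_basis.
by rewrite scalerA mulrC eq_sym.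
Qed.

Lemma munit_neq0 u v : e u v != 0.
Proof.
apply/eqP => /(congr1 (fun f => f (b v))); rewrite munit_basis eqxx scale1r => /eqP.
by rewrite (negbTE (basis_neq0 bB u)).
Qed.

Lemma munit_corner u x : A x -> e u u \o x \o e u u = diag bB u x *: e u u.
Proof.
move=> Ax; apply/funext => z; rewrite /munit /rank1 /diag /= fctE.
by rewrite (linear_funZ _ _ (ideal_linear idA Ax)) bcoordZ scalerA mulrC.
Qed.

Lemma diag_comp3 u x y z : UT b x -> UT b y -> UT b z ->
  diag bB u (x \o y \o z) = diag bB u x * diag bB u y * diag bB u z.
Proof.
move=> xU yU zU.
by rewrite (diag_comp bB u (UT_comp bB xU yU) zU) (diag_comp bB u xU yU).
Qed.

Section Automorphism.
Variable f : (V -> V) -> V -> V.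
Hypothesis fA : is_automorphism A f.

Let Ae u : A (e u u). Proof. exact: (ideal_munit idA). Qed.
Let Af x : A x -> A (f x). Proof. by have [[fF _ _] _ _] := fA => /fF. Qed.
Let fM x y : A x -> A y -> f (x \o y) = f x \o f y. Proof. by have [_ _] := fA; apply. Qed.

Let fM3 x y z : A x -> A y -> A z -> f (x \o y \o z) = f x \o f y \o f z.
Proof. by move=> Ax Ay Az; rewrite (fM (ideal_comp idA Ax Ay) Az) (fM Ax Ay). Qed.

Lemma automorphism_idem u : f (e u u) \o f (e u u) = f (e u u).
Proof. by rewrite -fM // munit_comp eqxx scale1r. Qed.

(** A triangular map multiplies the leading coordinate by its diagonal entry; on a fixed vector that
    entry cannot be 0. *)
Lemma idem_leading u w i : w != 0 -> f (e u u) w = w ->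
  (forall j, co w j != 0 -> (j <= i)%O) -> co w i != 0 -> diag bB i (f (e u u)) != 0.
Proof.
move=> w0 ew wle wi; have := UT_diag (ideal_UT idA (Af (Ae u))) wle.
rewrite ew -/(diag bB i _); apply: contra_eq_neq => ->; by rewrite mul0r.
Qed.

Lemma idem_diag u : exists i, diag bB i (f (e u u)) != 0.
Proof.
have := automorphism_neq0 fA (Ae u) (munit_neq0 u u).
move=> /(entry_neq0 bB (ideal_linear idA (Af (Ae u))))[i [j nz]].
set w := f (e u u) (b j) in nz.
have w0 : w != 0 by apply: contraNneq nz => ->; rewrite bcoord0.
have [k [wk kmax]] := leading_index bB w0; exists k.
apply: (idem_leading w0 _ kmax wk).
by rewrite -[LHS]/((f (e u u) \o f (e u u)) (b j)) automorphism_idem.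
Qed.

(** Primitivity of e_uu, carried over by surjectivity of [f]. *)
Lemma idem_corner u y : A y -> exists k, f (e u u) \o y \o f (e u u) = k *: f (e u u).
Proof.
move=> Ay; have [[_ _ fs] _ _] := fA; have [x Ax <-] := fs y Ay.
exists (diag bB u x); rewrite -(automorphismZ _ fA (Ae u)) -munit_corner //.
by rewrite (fM3 (Ae u) Ax (Ae u)).
Qed.

(** In f(e_uu) e_ii f(e_uu) = k f(e_uu) the diagonal entry at [i] forces k nonzero, the one at
    another position [j] forces k = 0. *)
Lemma idem_diag_unique u i j : diag bB i (f (e u u)) != 0 ->
  diag bB j (f (e u u)) != 0 -> i = j.
Proof.
move=> di dj; have [k E] := idem_corner u (Ae i).
have U := ideal_UT idA (Af (Ae u)); have Ui := ideal_UT idA (Ae i).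
have D t : diag bB t (f (e u u)) * diag bB t (e i i) * diag bB t (f (e u u)) =
    k * diag bB t (f (e u u)).
  by have := congr1 (diag bB t) E; rewrite (diag_comp3 t U Ui U) {4}/diag fctE bcoordZ.
apply/eqP; apply: contraT => ij.
have k0 : k != 0.
  apply/eqP => k0; have /eqP := D i; rewrite k0 mul0r diag_munit mulr1 mulf_eq0.
  by rewrite (negbTE di).
have /esym/eqP := D j; have -> : diag bB j (e i i) = 0.
  by rewrite /diag munit_basis (negbTE ij) scale0r bcoord0.
by rewrite mulr0 mul0r mulf_eq0 (negbTE k0) (negbTE dj).
Qed.

(** Orthogonality of the two idempotents excludes i = j. Moreover f(e_uv) sends some fixed vector of
    f(e_vv), of leading index [j], to a nonzero fixed vector of f(e_uu), of leading index [i], and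
    triangular maps never raise leading indices. *)
Lemma idem_diag_mono u v i j : (u < v)%O -> diag bB i (f (e u u)) != 0 ->
  diag bB j (f (e v v)) != 0 -> (i < j)%O.
Proof.
move=> uv di dj; have Auv : A (e u v) by apply: (ideal_munit idA); exact: ltW.
have Uuv := ideal_UT idA (Af Auv).
rewrite lt_neqAle; apply/andP; split.
  apply/eqP => ij; rewrite -ij in dj.
  have : f (e u u) \o f (e v v) = 0.
    by rewrite -fM // munit_comp gt_eqF // scale0r (automorphism0 fA).
  move=> /(congr1 (diag bB i)).
  rewrite (diag_comp bB i (ideal_UT idA (Af (Ae u))) (ideal_UT idA (Af (Ae v)))) => /eqP.
  by rewrite [X in _ == X]/diag bcoord0 mulf_eq0 (negbTE di) (negbTE dj).
have [k [l nz]] := entry_neq0 bB (UT_linear Uuv) (automorphism_neq0 fA Auv (munit_neq0 u v)).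
have Eu : f (e u u) \o f (e u v) = f (e u v) by rewrite -fM // munit_comp eqxx scale1r.
have Ev : f (e u v) \o f (e v v) = f (e u v) by rewrite -fM // munit_comp eqxx scale1r.
pose p := f (e v v) (b l).
have xp : f (e u v) p = f (e u v) (b l) by rewrite -[LHS]/((f (e u v) \o f (e v v)) (b l)) Ev.
have xp0 : f (e u v) p != 0 by rewrite xp; apply: contraNneq nz => ->; rewrite bcoord0.
have p0 : p != 0.
  by apply: contraNneq xp0 => ->; rewrite linear_fun0 //; exact: UT_linear Uuv.
have [j' [pj' pmax]] := leading_index bB p0.
have ep : f (e v v) p = p by rewrite -[LHS]/((f (e v v) \o f (e v v)) (b l)) automorphism_idem.
have jj' : j = j' by apply: (idem_diag_unique dj); exact: idem_leading p0 ep pmax pj'.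
have [i' [xi' xmax]] := leading_index bB xp0.
have exp : f (e u u) (f (e u v) p) = f (e u v) p.
  by rewrite -[LHS]/((f (e u u) \o f (e u v)) p) Eu.
have -> : i = i' by apply: (idem_diag_unique di); exact: idem_leading xp0 exp xmax xi'.
by rewrite jj'; exact: UT_le Uuv pmax _ xi'.
Qed.

End Automorphism.

(* An automorphism permutes the diagonal positions by an order automorphism of
   the index set, which is the identity on a well-order. *)
Lemma automorphism_diag f u : is_automorphism A f -> diag bB u (f (e u u)) != 0.
Proof.
move=> fA; have [f' f'A ff'] := automorphism_inverse fA.
have [p pP] := choice (idem_diag fA); have [q qP] := choice (idem_diag f'A).
have pmono : {homo p : u v / (u < v)%O}.
  by move=> x y xy; exact: (idem_diag_mono fA xy).
have qmono : {homo q : u v / (u < v)%O}.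
  by move=> x y xy; exact: (idem_diag_mono f'A xy).
have Ae x : A (e x x) by exact: (ideal_munit idA).
have Af x : A x -> A (f x) by have [[fF _ _] _ _] := fA => /fF.
have Af' x : A x -> A (f' x) by have [[fF _ _] _ _] := f'A => /fF.
(* With q = q(i), applying [f] to the corner of f'(e_ii) at e_qq gives f(e_qq) e_ii f(e_qq) as a
   nonzero multiple of f(e_qq). Its entry at p(q) is nonzero, so e_ii has a nonzero entry there. *)
have pq i : p (q i) = i.
  have := munit_corner (q i) (Af' _ (Ae i)) => /(congr1 f).
  have [_ _ fM] := fA; have Afi := Af' _ (Ae i); have Aq := Ae (q i).
  rewrite (automorphismZ _ fA Aq) (fM _ _ (ideal_comp idA Aq Afi) Aq) (fM _ _ Aq Afi).
  rewrite (ff' _ (Ae i)); set j := p (q i); move=> /(congr1 (diag bB j)).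
  have U := ideal_UT idA (Af _ (Ae (q i))); have Ui := ideal_UT idA (Ae i).
  rewrite (diag_comp3 j U Ui U) [X in _ = X]/diag fctE bcoordZ -/(diag bB j _) => E.
  apply/eqP; apply: contraT => ji; have /eqP := E.
  have -> : diag bB j (e i i) = 0.
    by rewrite /diag munit_basis eq_sym (negbTE ji) scale0r bcoord0.
  by rewrite mulr0 mul0r eq_sym mulf_eq0 (negbTE (qP i)) (negbTE (pP (q i))).
have qid i : q i = i.
  (* Both [p] and [q] dominate the identity while p(q(i)) = i, which leaves only equality. *)
  apply/le_anti/andP; split; last exact: (strict_mono_ge I_wo qmono).
  by rewrite -{2}[i]pq; exact: (strict_mono_ge I_wo pmono).
have pu : p u = u by rewrite -{1}[u]qid pq.
by have := pP u; rewrite pu.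
Qed.

(** The image of e_ov, with o least, keeps its degree. Its entry at (o, v) turns out to be nonzero,
    so the same degree is read off in [eta']. *)
Lemma iso_degrees (eta eta' : I -> G) :
  grading_iso A (fun g => [set a | A a /\ homdeg bB eta g a])
                (fun g => [set a | A a /\ homdeg bB eta' g a]) ->
  exists g : G, forall u, eta u = (g * eta' u)%g.
Proof.
move=> [f fA fg].
have [[i0 _]|noI] := pselect (exists i : I, True); last first.
  by exists 1%g => w; case: noI; exists w.
have [o omin] := well_ordered_min I_wo i0.
exists (eta o * (eta' o)^-1)%g => v.
suff : ((eta' o)^-1 * eta' v = (eta o)^-1 * eta v)%g.
  by move=> E; rewrite -mulgA E mulVKg.
have Aov : A (e o v) by exact: (ideal_munit idA).
have [Afov hov] : [set a | A a /\ homdeg bB eta' ((eta o)^-1 * eta v)%g a] (f (e o v)).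
  by rewrite -fg; exists (e o v) => //; split => //; exact: homdeg_munit.
have Ae x : A (e x x) by exact: (ideal_munit idA).
have [[fF _ _] _ fM] := fA.
have Afe x : A (f (e x x)) by exact: fF.
have U x := ideal_UT idA (Afe x).
have Ev : f (e o v) \o f (e v v) = f (e o v) by rewrite -fM // munit_comp eqxx scale1r.
have Eo : f (e o o) \o f (e o v) = f (e o v) by rewrite -fM // munit_comp eqxx scale1r.
have dv := automorphism_diag v fA.
have lov := ideal_linear idA Afov.
have xv0 : f (e o v) (b v) != 0.
  (* Here f(e_vv) e_vv f(e_vv) = k f(e_vv) with k nonzero, so k f(e_ov) factors through the vector
     f(e_ov)(b v). If that vector were 0, f(e_ov) would vanish. *)
  apply/eqP => xv; have [k kE] := idem_corner fA v (Ae v).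
  have k0 : k != 0.
    apply/eqP => k0; have := congr1 (diag bB v) kE.
    rewrite k0 scale0r (diag_comp3 v (U v) (ideal_UT idA (Ae v)) (U v)) => /eqP.
    rewrite [X in _ == X]/diag bcoord0 diag_munit mulr1 mulf_eq0.
    by rewrite (negbTE dv).
  have /eqP := automorphism_neq0 fA Aov (munit_neq0 o v); apply.
  suff : k *: f (e o v) = 0.
    by move/(congr1 (fun y => k^-1 *: y)); rewrite scalerA mulVf // scale1r scaler0.
  have -> : k *: f (e o v) = f (e o v) \o (k *: f (e v v)).
    by rewrite -{1}Ev; apply/funext => x; rewrite /= !fctE linear_funZ.
  rewrite -kE; apply/funext => x /=.
  rewrite -[LHS]/((f (e o v) \o f (e v v)) (e v v (f (e v v) x))) Ev.
  by rewrite /munit /rank1 linear_funZ // xv scaler0.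
have [i [xi imax]] := leading_index bB xv0.
have ex : f (e o o) (f (e o v) (b v)) = f (e o v) (b v).
  by rewrite -[LHS]/((f (e o o) \o f (e o v)) (b v)) Eo.
(* The vector is fixed by f(e_oo), whose only nonzero diagonal position is [o]. *)
have io : i = o.
  apply: (idem_diag_unique fA _ (automorphism_diag o fA)).
  exact: idem_leading fA _ _ _ xv0 ex imax xi.
by rewrite io in xi; exact: hov xi.
Qed.

Lemma elementary_grading_eq (eta eta' : I -> G) :
  (forall g, elementary_grading b eta g = elementary_grading b eta' g) ->
  exists g : G, forall u, eta u = (g * eta' u)%g.
Proof.
move=> eq_eta; have [[i0 _]|noI] := pselect (exists i : I, True); last first.
  by exists 1%g => w; case: noI; exists w.
have [o omin] := well_ordered_min I_wo i0.
exists (eta o * (eta' o)^-1)%g => v.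
have : elementary_grading b eta ((eta o)^-1 * eta v)%g (e o v).
  by apply: sub_lin_span; exists o, v; rewrite (matrix_unitE bB).
rewrite eq_eta => /(elementary_grading_homdeg bB)[_] /(_ o v).
rewrite munit_basis eqxx scale1r bcoord_basis eqxx oner_neq0 => /(_ isT) E.
by rewrite -mulgA E mulVKg.
Qed.

End Uniqueness.

(** * Assembly for both algebras and the four equivalent statements *)

Lemma grading_iso_refl (F : fieldType) (V : lmodType F) (G : groupType)
  (A : set (V -> V)) (Gm : G -> set (V -> V)) : grading_iso A Gm Gm.
Proof.
exists id => [|g]; last exact: image_id.
by split => //; split => // a Aa; exists a.
Qed.

Theorem theorem41 (F : fieldType) (V : lmodType F)
    (d : Order.disp_t) (I : orderType d) (b : I -> V) (G : groupType)
    (I_wo : well_ordered I) (b_basis : is_basis b) :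
  (forall A : set (V -> V), A = UT b \/ A = UTfin b ->
   forall Gm : G -> set (V -> V), is_grading A Gm ->
     finite_support Gm /\
     exists Gm' : G -> set (V -> V),
       [/\ is_grading A Gm', elementary b Gm', grading_iso A Gm Gm' &
           exists Gm0 : G -> set (V -> V),
             [/\ is_grading (UTarrow b) Gm0, elementary b Gm0,
                 finite_support Gm0 &
                 forall g, Gm' g = induced_grading A Gm0 g]])
  /\
  (forall eta eta' : I -> G,
     finite_support (elementary_grading b eta) ->
     finite_support (elementary_grading b eta') ->
     [<-> grading_iso (UT b)
            (induced_grading (UT b) (elementary_grading b eta))
            (induced_grading (UT b) (elementary_grading b eta'));
          grading_iso (UTfin b)
            (induced_grading (UTfin b) (elementary_grading b eta))
            (induced_grading (UTfin b) (elementary_grading b eta'));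
          forall g, elementary_grading b eta g = elementary_grading b eta' g;
          exists g : G, forall u, eta u = (g * eta' u)%g]).
Proof.
have idUT := UT_UT_ideal b_basis; have idUTfin := UTfin_UT_ideal b_basis.
split=> [A AE Gm gr|eta eta' _ _].
  have idA : UT_ideal b_basis A by case: AE => ->.
  exact: (grading_classification I_wo idA).
have iso_degrees_induced A : UT_ideal b_basis A ->
    grading_iso A (induced_grading A (elementary_grading b eta))
                  (induced_grading A (elementary_grading b eta')) ->
    exists g : G, forall u, eta u = (g * eta' u)%g.
  move=> idA iso; apply: (iso_degrees I_wo idA).
  have E eta0 : induced_grading A (elementary_grading b eta0) =
      fun g => [set a | A a /\ homdeg b_basis eta0 g a].
    by apply/funext => g; exact: induced_homdeg.
  by rewrite -!E.
have eq_degrees : (exists g : G, forall u, eta u = (g * eta' u)%g) ->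
    elementary_grading b eta = elementary_grading b eta'.
  move=> [g gE]; apply/funext => h; rewrite /elementary_grading.
  suff E u v : ((eta u)^-1 * eta v)%g = ((eta' u)^-1 * eta' v)%g.
    by congr lin_span; apply/seteqP; split=> t /= [u [v [uv <- ->]]]; exists u, v; rewrite E.
  by rewrite !gE invgM -mulgA mulKg.
(* The first two implications of the cycle pass through the last statement, which gives literal
   equality of the elementary gradings. *)
tfae.
- by move=> /(iso_degrees_induced _ idUT)/eq_degrees ->; exact: grading_iso_refl.
- by move=> /(iso_degrees_induced _ idUTfin)/eq_degrees ->.
- exact: (elementary_grading_eq I_wo b_basis).
- by move=> /eq_degrees ->; exact: grading_iso_refl.
Qed.
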